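(* Let $X$ be a real Banach space of dimension greater than one and let $T:X\rightrightarrows X^*$ be a multifunction whose domain $D(T)$ is not a singleton and such that ${}^{ic}D(T)\neq\emptyset$. Then $T$ is maximal monotone if and only if $T=T+N_{\operatorname{aff}D(T)}$, $T$ is representable, and for every $x\in D(T)\setminus{}^{ic}D(T)$ there is $y\in{}^{ic}D(T)$ such that $\sup\{\langle x-y,x^*\rangle\mid x^*\in T(x)\}=+\infty$. In this case ${}^{ic}D(T)=\operatorname{ri}D(T)$ and $D(T)$ is nearly-convex.
   Context: $X^*$ is the topological dual of $X$, $\langle x,x^*\rangle:=x^*(x)$. A multifunction $T:X\rightrightarrows X^*$ is identified with its graph $\{(x,x^* )\mid x^*\in T(x)\}$; its domain is $D(T)=\{x\mid T(x)\neq\emptyset\}$. $T$ is monotone if $\langle x_1-x_2,x_1^*-x_2^*\rangle\ge0$ for all $(x_1,x_1^* ),(x_2,x_2^* )\in T$; it is maximal monotone if it is monotone and its graph is not properly contained in the graph of another monotone operator $X\rightrightarrows X^*$. Sums are pointwise. For $C\subset X$, $N_C(x)=\{x^*\in X^*\mid\langle y-x,x^*\rangle\le0\ \forall y\in C\}$ if $x\in C$, $N_C(x)=\emptyset$ otherwise. $\operatorname{aff}S$ is the affine hull of $S$; $\operatorname{ri}S$ is the interior of $S$ relative to the norm closure of $\operatorname{aff}S$. The relative algebraic interior ${}^{i}S$ is the set of $s\in S$ such that for every $u\in\operatorname{aff}S$ there is $\rho>0$ with $(1-\lambda)s+\lambda u\in S$ for all $\lambda\in[0,\rho]$; ${}^{ic}S:={}^{i}S$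 if $\operatorname{aff}S$ is norm closed, ${}^{ic}S:=\emptyset$ otherwise. $S$ is nearly-convex if there is a convex set $C$ with $\operatorname{ri}C\neq\emptyset$ and $C\subset S\subset\overline C$. $T$ is representable if there is a proper convex function $f:X\times X^*\to\mathbb{R}\cup\{+\infty\}$, lower semicontinuous for the norm$\times$weak-star topology, with $f(x,x^* )\ge\langle x,x^*\rangle$ everywhere and $T=\{(x,x^* )\mid f(x,x^* )=\langle x,x^*\rangle\}$. *)

(* Defs.v *)
From HB Require Import structures.
From mathcomp Require Import all_boot all_order all_algebra.
From mathcomp Require Import all_classical all_reals all_analysis.

Set Implicit Arguments.
Unset Strict Implicit.
Unset Printing Implicit Defensive.

Import Order.TTheory GRing.Theory Num.Theory.
Import numFieldNormedType.Exports.

Local Open Scope classical_set_scope.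
Local Open Scope convex_scope.
Local Open Scope ring_scope.

Section Dual.
Context {R : realType} (X : normedModType R).

Definition continuous_linear : {pred X -> R^o} :=
  fun f => `[< linear f /\ continuous f >].

Fact continuous_linear_submod_closed : submod_closed continuous_linear.
Proof.
split=> [|a f g /asboolP[lf cf] /asboolP[lg cg]]; apply/asboolP; split.
- by move=> c x y /=; rewrite scaler0 addr0.
- exact: cst_continuous.
- move=> c x y /=.
  change (a *: f (c *: x + y) + g (c *: x + y) =
    c *: (a *: f x + g x) + (a *: f y + g y)).
  by rewrite lf lg !scalerDr !scalerA (mulrC a c) addrACA.
- by move=> x; apply: cvgD (cg x); apply: cvgZ (cf x); exact: cvg_cst.
Qed.

HB.instance Definition _ := GRing.isSubmodClosed.Build R (X -> R^o)
  continuous_linear continuous_linear_submod_closed.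

Record dual_space := DualSpace {
  dual_fun :> X -> R^o;
  dual_funP : dual_fun \in continuous_linear }.

HB.instance Definition _ := [isSub for dual_fun].
HB.instance Definition _ := [Choice of dual_space by <:].
HB.instance Definition _ := [SubChoice_isSubLmodule of dual_space by <:].

(* The dual space with the weak-star topology, i.e. the coarsest topology
   making all the evaluations u |-> u x continuous. *)
Definition weak_star : Type := dual_space.

HB.instance Definition _ := Topological.copy weak_star
  (initial_topology (fun u : dual_space => (u : {ptws X -> R^o}))).

End Dual.

Section ConvexGeometry.
Context {R : realType} {X : normedModType R}.
Implicit Types S A C : set X.

Definition dim_gt1 (V : lmodType R) : Prop :=
  exists x y : V, forall a b : R, a *: x + b *: y = 0 -> a = 0 /\ b = 0.

Definition affine_set A :=
  forall x y (t : R), A x -> A y -> A ((1 - t) *: x + t *: y).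

Definition aff S : set X := smallest affine_set S.

(* In [subspace B] the points outside B are isolated, but S is included in
   [closure (aff S)], so they do not contribute to this interior. *)
Definition ri S : set X := (S : set (subspace (closure (aff S))))°.

Definition rel_alg_int S : set X :=
  [set s | S s /\ forall u, aff S u -> exists2 rho : R, 0 < rho &
    forall l : R, 0 <= l <= rho -> S ((1 - l) *: s + l *: u)].

Definition ic S : set X :=
  if `[< closed (aff S) >] then rel_alg_int S else set0.

Definition nearly_convex S := exists C,
  [/\ convex_set (C : set (convex_lmodType X)), ri C !=set0,
      C `<=` S & S `<=` closure C].

Definition normal_cone C (x : X) : set (dual_space X) :=
  [set u | C x /\ forall y, C y -> u (y - x) <= 0].

End ConvexGeometry.

Section Multifunction.
Context {R : realType} {X : normedModType R}.
Implicit Types T S : X -> set (dual_space X).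

Definition graph T : set (X * dual_space X) := [set z | T z.1 z.2].

Definition domain T : set X := [set x | T x !=set0].

Definition multi_add T S : X -> set (dual_space X) :=
  fun x => [set w | exists2 u, T x u & exists2 v, S x v & w = u + v].

Definition monotone_multi T := forall x1 x2 u1 u2,
  graph T (x1, u1) -> graph T (x2, u2) -> 0 <= (u1 - u2) (x1 - x2).

Definition maximal_monotone T :=
  monotone_multi T /\ ~ exists2 S, monotone_multi S & graph T `<` graph S.

(* Since 0 * +oo = 0 in [\bar R], the cases t = 0 and t = 1 are vacuous. *)
Definition convex_efun (V : lmodType R) (f : V -> \bar R) :=
  forall (t : {i01 R}) (z w : convex_lmodType V),
    (f (z <| t |> w) <= t%:num%:E * f z + (1 - t%:num)%:E * f w)%E.

Definition proper_efun (V : Type) (f : V -> \bar R) :=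
  (forall z, f z != -oo%E) /\ (exists z, f z != +oo%E).

Definition representable T := exists f : X * dual_space X -> \bar R,
  [/\ proper_efun f, convex_efun f,
      lower_semicontinuous (f : X * weak_star X -> \bar R),
      forall (x : X) (u : dual_space X), ((u x)%:E <= f (x, u))%E
    & graph T = [set z | f z = (z.2 z.1)%:E] ].

End Multifunction.

(* Main.v *)
Require Import Defs.
From HB Require Import structures.
From mathcomp Require Import all_boot all_order all_algebra.
From mathcomp Require Import all_classical all_reals all_analysis.
From mathcomp Require Import ring lra.

Set Implicit Arguments.
Unset Strict Implicit.
Unset Printing Implicit Defensive.

Import Order.TTheory GRing.Theory Num.Theory.
Import numFieldNormedType.Exports.

Local Open Scope classical_set_scope.
Local Open Scope ring_scope.

(** Write A for the affine hull of D(T) and F for its direction. Let T be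
    maximal monotone and let p >= phi(a, u) for the Fitzpatrick function phi of T.
    At a relative algebraic interior point x of D(T), Banach-Steinhaus gives
      r |u|_F <= p - <x, u> + M (1 + |a|)                                   (1)
    for some r > 0. Conversely, Hahn-Banach turns (1) into a functional v such
    that (x, v) is monotonically related to T, so that x is in D(T). Thus ic D(T)
    is the set of the x in A satisfying (1), which is convex, relatively open and
    dense in D(T). A functional supporting D(T) at a point of D(T) \ ic D(T) can
    be added to the values of T there, whence the growth condition.

    For the converse, let (x0, u0) be monotonically related to T but not in T,
    and let f represent T. Separating (x0, u0) from the epigraph of f yields a
    nearby pair (x1, u1) with <x1 - a, u1 - u> >= de > 0 for all (a, u) in T. Join
    y0 in ic D(T) to x1 by a segment. By (1) at y0, the values of T along this
    segment are bounded on F, so by the growth condition a point of [y0, x1[ lies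
    in ic D(T) as soon as it lies in D(T); by weak-star compactness D(T) is closed
    along the segment. Hence [y0, x1[ is contained in D(T), and letting a tend to
    x1 along it contradicts the gap de. *)

(** * Hahn-Banach *)

Section HahnBanach.
Context {R : realType} {V : lmodType R}.
Implicit Types (p q N : V -> R) (E : set (V * R)) (x y w : V) (s t : R).

(** One inequality suffices for homogeneity: applied with [t^-1] it yields the reverse one. *)
Definition sublinear p :=
  (forall x y, p (x + y) <= p x + p y) /\
  (forall t x, 0 < t -> p (t *: x) <= t * p x).

Definition convex_pairs E := forall t w1 s1 w2 s2, 0 <= t <= 1 ->
  E (w1, s1) -> E (w2, s2) ->
  E (t *: w1 + (1 - t) *: w2, t * s1 + (1 - t) * s2).

Lemma sublinear0 p : sublinear p -> p 0 = 0.
Proof.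
move=> [padd phom]; have := padd 0 0; have := phom 2^-1 0.
by rewrite scaler0 addr0 invr_gt0 ltr0n => /(_ isT) ? ?; lra.
Qed.

Lemma sublinearN_ge p x : sublinear p -> - p (- x) <= p x.
Proof.
move=> sp; have := sp.1 x (- x).
by rewrite subrr (sublinear0 sp) => ?; lra.
Qed.

Lemma sublinear_hom p t x : sublinear p -> 0 < t -> p (t *: x) = t * p x.
Proof.
move=> sp t0; apply/eqP; rewrite eq_le sp.2//=.
have := sp.2 t^-1 (t *: x); rewrite scalerA mulVf ?gt_eqF// scale1r invr_gt0.
by move=> /(_ t0); rewrite -(ler_pM2l t0) mulrA divff ?gt_eqF// mul1r.
Qed.

Lemma sublinear_odd_linear p :
  sublinear p -> (forall x, p (- x) <= - p x) -> linear p.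
Proof.
move=> sp oddp.
have pN x : p (- x) = - p x.
  by have := sublinearN_ge x sp; have := oddp x => ? ?; apply: le_anti; lra.
have pD x y : p (x + y) = p x + p y.
  apply: le_anti; rewrite sp.1/=.
  have := sp.1 (x + y) (- y); rewrite addrK pN => ?; lra.
have pZ t x : p (t *: x) = t * p x.
  have [t0|t0|->] := ltgtP t 0; last by rewrite scale0r mul0r sublinear0.
    rewrite -[t]opprK scaleNr pN sublinear_hom ?oppr_gt0//; ring.
  exact: sublinear_hom.
by move=> t x y; rewrite pD pZ.
Qed.

Lemma inf_le_add (A B C : set R) : B !=set0 -> C !=set0 -> has_lbound A ->
  (forall b c, B b -> C c -> exists2 a, A a & a <= b + c) ->
  inf A <= inf B + inf C.
Proof.
move=> B0 C0 lA ABC; rewrite -lerBlDr; apply: lb_le_inf => // b Bb.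
rewrite lerBlDr -lerBlDl; apply: lb_le_inf => // c Cc.
rewrite lerBlDl; have [a Aa /(le_trans _)] := ABC b c Bb Cc; apply.
exact: ge_inf.
Qed.

(** Infimal convolution of [p] with the cone generated by [E]. Under the hypotheses of the next
    lemma it is the largest sublinear function below [p] and below [s] at [w] for each [(w, s)] in
    [E]. *)
Definition conic_minorant p E w : R :=
  inf [set r | exists t w' s, [/\ 0 <= t, E (w', s) &
    r = t * s + p (w - t *: w')]].

(** The compatibility hypothesis bounds the infimum below by [- p (- w)]. Convexity of [E] makes its
    cone closed under sums, whence subadditivity. *)
Lemma sublinear_conic_minorant p E : sublinear p -> E !=set0 ->
  convex_pairs E -> (forall w s, E (w, s) -> 0 <= s + p (- w)) ->
  [/\ sublinear (conic_minorant p E), forall w, conic_minorant p E w <= p w &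
    forall w s, E (w, s) -> conic_minorant p E w <= s].
Proof.
move=> sp [[w0 s0] Ew0] cE Ege0.
pose S w := [set r | exists t w' s, [/\ 0 <= t, E (w', s) &
  r = t * s + p (w - t *: w')]].
have S_neq0 w : S w !=set0 by exists (0 * s0 + p (w - 0 *: w0)), 0, w0, s0.
have S_lb w : has_lbound (S w).
  exists (- p (- w)) => _ [t [w' [s [t0 Ew' ->]]]].
  have := sp.1 (w - t *: w') (- w).
  rewrite addrAC subrr add0r.
  suff : 0 <= t * s + p (- (t *: w')) by lra.
  move: t0; rewrite le_eqVlt => /predU1P[<-|t0].
    by rewrite mul0r scale0r oppr0 sublinear0// addr0.
  by rewrite -scalerN sublinear_hom// -mulrDr mulr_ge0 ?(ltW t0)//; exact: Ege0.
split; first split.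
- move=> x y; apply: inf_le_add (S_neq0 _) (S_neq0 _) (S_lb _) _.
  move=> _ _ [t1 [w1 [s1 [t10 Ew1 ->]]]] [t2 [w2 [s2 [t20 Ew2 ->]]]].
  have [t0|t0] := leP (t1 + t2) 0.
    have [-> ->] : t1 = 0 /\ t2 = 0 by split; lra.
    exists (p (x + y)).
      by exists 0, w1, s1; rewrite scale0r subr0 mul0r add0r.
    by rewrite !scale0r !subr0 !mul0r !add0r sp.1.
  (* [t1 *: w1 + t2 *: w2] is [t1 + t2] times the convex combination of weight [l]. *)
  pose l := t1 / (t1 + t2).
  have l2 : (t1 + t2) * (1 - l) = t2 by rewrite /l; field; rewrite gt_eqF.
  have l1 : (t1 + t2) * l = t1 by rewrite /l; field; rewrite gt_eqF.
  have l01 : 0 <= l <= 1.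
    by rewrite divr_ge0 ?(ltW t0)//= ler_pdivrMr// mul1r lerDl.
  move: l l1 l2 l01 => l l1 l2 l01.
  exists (t1 * s1 + t2 * s2 + p (x + y - (t1 *: w1 + t2 *: w2))).
    exists (t1 + t2), (l *: w1 + (1 - l) *: w2), (l * s1 + (1 - l) * s2).
    split; [exact: ltW|exact: cE|].
    by rewrite mulrDr scalerDr !scalerA !mulrA l1 l2.
  have := sp.1 (x - t1 *: w1) (y - t2 *: w2).
  by rewrite addrACA -opprD; lra.
- move=> t x t0.
  rewrite -ler_pdivrMl// mulrC; apply: (lb_le_inf (S_neq0 x)).
  move=> _ [t1 [w1 [s1 [t10 Ew1 ->]]]].
  rewrite ler_pdivrMr//; apply: (ge_inf (S_lb _)).
  exists (t * t1), w1, s1; split => //; first by rewrite mulr_ge0 // ltW.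
  by rewrite -scalerA -scalerBr sublinear_hom//; ring.
- move=> w; apply: (ge_inf (S_lb _)); exists 0, w0, s0.
  by rewrite mul0r scale0r subr0 add0r.
- move=> w s Ews; apply: (ge_inf (S_lb _)); exists 1, w, s.
  by rewrite scale1r subrr sublinear0// mul1r addr0.
Qed.

(** Zorn's lemma for the reversed pointwise order yields a minimal sublinear function below [N];
    minimality forces it to be odd, hence linear. *)
Lemma sublinear_linear_minorant N :
  sublinear N -> exists2 L : V -> R, linear L & forall x, L x <= N x.
Proof.
move=> sN; pose T := {p : V -> R | sublinear p /\ forall x, p x <= N x}.
pose ler_fun (p q : T) := `[< forall x, sval q x <= sval p x >].
have [||||[p [sp pN]] pmin] := @Zorn T ler_fun.
- by move=> p; apply/asboolP.
- move=> p q r /asboolP pq /asboolP qr; apply/asboolP => x.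
  exact: le_trans (qr x) (pq x).
- move=> [p Pp] [q Pq] /asboolP/= pq /asboolP/= qp; apply/eq_exist/funext => x.
  by apply: le_anti; rewrite pq qp.
- move=> A totA; have [[p0 Ap0]|/set0P/negP] := pselect (A !=set0); last first.
    rewrite negbK => /eqP ->.
    by exists (exist _ N (conj sN (fun x => lexx (N x)))).
  pose S x := [set sval p x | p in A].
  have S_neq0 x : S x !=set0 by exists (sval p0 x), p0.
  have S_lb x : has_lbound (S x).
    exists (- N (- x)) => _ [[p [sp pN]] Ap <-] /=.
    have := sublinearN_ge x sp; have := pN (- x); lra.
  have Sle x (p : T) : A p -> inf (S x) <= sval p x.
    by move=> Ap; apply: (ge_inf (S_lb _)); exists p.
  have sS : sublinear (fun x => inf (S x)).
    split=> [x y|t x t0].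
      apply: inf_le_add (S_neq0 _) (S_neq0 _) (S_lb _) _ => _ _ [p Ap <-] [q Aq <-].
      have [/asboolP pq|/asboolP qp] := totA _ _ Ap Aq.
        exists (sval q (x + y)); first by exists q.
        case: q {Aq} pq => q [sq qN] /= pq.
        by have := sq.1 x y; have := pq x; lra.
      exists (sval p (x + y)); first by exists p.
      case: p {Ap} qp => p [sp pN] /= qp.
      by have := sp.1 x y; have := qp y; lra.
    rewrite -ler_pdivrMl// mulrC; apply: (lb_le_inf (S_neq0 x)) => _ [p Ap <-].
    rewrite ler_pdivrMr// mulrC; apply: (le_trans (Sle _ _ Ap)).
    by case: p {Ap} => p [sp pN] /=; exact: sp.2.
  have SN x : inf (S x) <= N x.
    by apply: (le_trans (Sle _ _ Ap0)); case: p0 {Ap0} => p [].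
  exists (exist _ (fun x => inf (S x)) (conj sS SN)) => p Ap.
  by apply/asboolP => x /=; exact: Sle.
exists p => //; apply: sublinear_odd_linear => // x.
(* By minimality the conic minorant for this single pair is [p] itself, so [p (- x) <= - p x]. *)
pose E : set (V * R) := [set (- x, - p x)].
have [|||sq qp qE] := @sublinear_conic_minorant p E sp.
- by exists (- x, - p x).
- move=> t w1 s1 w2 s2 _ [-> ->] [-> ->]; rewrite /E/=.
  by congr pair; [rewrite -scalerDl addrC subrK scale1r|ring].
- by move=> w s [-> ->]; rewrite opprK addNr.
have := pmin (exist _ (conic_minorant p E)
  (conj sq (fun x => le_trans (qp x) (pN x)))).
have pq : `[< forall x, conic_minorant p E x <= p x >] by exact/asboolP.
by move=> /(_ pq)/(congr1 sval)/= {1}<-; exact: qE.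
Qed.

(** A pair [(w, s)] prescribes the bound [s] on the functional at [w]; every later separation is an
    instance for a suitable [E]. *)
Theorem sandwich N E : sublinear N -> E !=set0 -> convex_pairs E ->
  (forall w s, E (w, s) -> 0 <= s + N (- w)) ->
  exists L : V -> R, [/\ linear L, forall x, L x <= N x &
    forall w s, E (w, s) -> L w <= s].
Proof.
move=> sN E0 cE EN; have [sq qN qE] := sublinear_conic_minorant sN E0 cE EN.
have [L linL Lq] := sublinear_linear_minorant sq.
exists L; split=> // [x|w s Ews]; first exact: le_trans (qN x).
exact: le_trans (qE _ _ Ews).
Qed.

End HahnBanach.

(** * Functionals on a normed space *)

Section DualSpace.
Context {R : realType} {X : normedModType R}.
Implicit Types (u v : dual_space X) (x y w : X) (s t K : R) (F : set X).

(* Values of functionals are taken in [R], not in the regular module [R^o]. *)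
Definition ev u x : R := u x.

Lemma dual_linear u : linear u.
Proof. by have /asboolP[] := dual_funP u. Qed.

Lemma dual_continuous u : continuous u.
Proof. by have /asboolP[] := dual_funP u. Qed.

Lemma dualD u x y : ev u (x + y) = ev u x + ev u y.
Proof. by have := dual_linear u 1 x y; rewrite !scale1r. Qed.

Lemma dual0 u : ev u 0 = 0.
Proof. by have := dualD u 0 0; rewrite addr0 => ?; lra. Qed.

Lemma dualZ u t x : ev u (t *: x) = t * ev u x.
Proof.
have := dual_linear u t x 0; rewrite addr0 => E.
by rewrite /ev E -/(ev u 0) dual0 addr0.
Qed.

Lemma dualN u x : ev u (- x) = - ev u x.
Proof. by rewrite -scaleN1r dualZ mulN1r. Qed.

Lemma dualB u x y : ev u (x - y) = ev u x - ev u y.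
Proof. by rewrite dualD dualN. Qed.

Lemma dual_addE u v x : ev (u + v) x = ev u x + ev v x.
Proof. by []. Qed.

Lemma dual_oppE u x : ev (- u) x = - ev u x.
Proof. by []. Qed.

Lemma dual_scaleE t u x : ev (t *: u) x = t * ev u x.
Proof. by []. Qed.

Lemma dual_subE u v x : ev (u - v) x = ev u x - ev v x.
Proof. by []. Qed.

Lemma dual_bounded u : exists2 K, 0 < K & forall x, `|ev u x| <= K * `|x|.
Proof.
have := @dual_continuous u 0 => /cvgrPdist_lt/(_ 1 ltr01).
move=> /nbhs_ballP[e /= e0 eu].
have {}eu y : `|y| < e -> `|ev u y| < 1.
  move=> ye; have := eu y; rewrite -ball_normE /= sub0r normrN => /(_ ye).
  by change (`|ev u 0 - ev u y| < 1 -> `|ev u y| < 1); rewrite dual0 sub0r normrN.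
exists (2 / e); first by rewrite divr_gt0.
move=> x; have [->|x0] := eqVneq x 0; first by rewrite dual0 !normr0 mulr0.
have nx : 0 < `|x| by rewrite normr_gt0.
have c0 : 0 < e / 2 / `|x| by rewrite !divr_gt0.
have := eu ((e / 2 / `|x|) *: x).
rewrite normrZ gtr0_norm// divfK ?gt_eqF// dualZ normrM gtr0_norm//.
have e2 : e / 2 < e by lra.
move=> /(_ e2) /ltW; rewrite -ler_pdivlMl// => /le_trans; apply.
by rewrite mulr1 invf_div mulrC invf_div.
Qed.

Lemma bounded_dual (L : X -> R) K : linear L ->
  (forall x, L x <= K * `|x|) -> exists u, forall x, ev u x = L x.
Proof.
move=> linL LK.
have L0 : L 0 = 0.
  by have := linL 1 0 0; rewrite scaler0 addr0 scale1r => ?; lra.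
have LB x y : L (y - x) = L y - L x.
  by have := linL (-1) x y; rewrite !scaleN1r => E; rewrite addrC E addrC.
have absL x : `|L x| <= K * `|x|.
  rewrite ler_norml LK andbT lerNl.
  by have := LK (- x); rewrite normrN -(sub0r x) LB L0 sub0r.
have contL : continuous (L : X -> R^o).
  move=> x; apply/cvgrPdist_lt => e e0.
  have K1 : 0 < `|K| + 1 by rewrite ltr_wpDl.
  near=> y; rewrite -LB; apply: (le_lt_trans (absL _)).
  apply: (@le_lt_trans _ _ ((`|K| + 1) * `|x - y|)).
    by rewrite ler_wpM2r// (le_trans (ler_norm K))// lerDl.
  rewrite -ltr_pdivlMl//; near: y; apply/nbhs_ballP.
  exists ((`|K| + 1)^-1 * e) => /=; first by rewrite mulr_gt0 ?invr_gt0.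
  by move=> y; rewrite -ball_normE.
have Lin : (L : X -> R^o) \in @continuous_linear R X by apply/asboolP; split.
by exists (DualSpace Lin).
Unshelve. all: by end_near. Qed.

Lemma sublinear_norm K : 0 <= K -> sublinear (fun x : X => K * `|x|).
Proof.
move=> K0; split=> [x y|t x t0].
  by rewrite -mulrDr ler_wpM2l// ler_normD.
by rewrite normrZ gtr0_norm// mulrCA.
Qed.

Lemma dual_sandwich K (E : set (X * R)) : 0 <= K -> E !=set0 ->
  convex_pairs E -> (forall w s, E (w, s) -> 0 <= s + K * `|w|) ->
  exists u, (forall x, `|ev u x| <= K * `|x|) /\
    (forall w s, E (w, s) -> ev u w <= s).
Proof.
move=> K0 E0 cE EK.
have [|L [linL LK LE]] := sandwich (sublinear_norm K0) E0 cE.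
  by move=> w s /EK; rewrite normrN.
have [u uL] := bounded_dual linL LK.
exists u; split=> [x|w s Ews]; last by rewrite uL; exact: LE.
rewrite ler_norml uL LK andbT lerNl -uL -dualN uL -(normrN x); exact: LK.
Qed.

Definition linear_subspace F := F 0 /\ forall t x y, F x -> F y -> F (t *: x + y).

Lemma linear_subspaceD F x y : linear_subspace F -> F x -> F y -> F (x + y).
Proof. by move=> [_ FD] Fx Fy; rewrite -(scale1r x); exact: FD. Qed.

Lemma linear_subspaceZ F t x : linear_subspace F -> F x -> F (t *: x).
Proof. by move=> [F0 FD] Fx; rewrite -(addr0 (t *: x)); exact: FD. Qed.

Lemma linear_subspaceN F x : linear_subspace F -> F x -> F (- x).
Proof. by move=> sF Fx; rewrite -scaleN1r; exact: linear_subspaceZ. Qed.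

(** Here [E] is the graph of [u] on [F]; as [F] is symmetric, the upper bounds on [F] become
    equalities. *)
Lemma dual_extension F u K : 0 <= K -> linear_subspace F ->
  (forall b, F b -> `|ev u b| <= K * `|b|) ->
  exists v, (forall x, `|ev v x| <= K * `|x|) /\ forall b, F b -> ev v b = ev u b.
Proof.
move=> K0 sF uK.
pose E : set (X * R) := [set z | F z.1 /\ z.2 = ev u z.1].
have [||w s [/= Fw ->]|v [vK vE]] := @dual_sandwich K E K0.
- by exists (0, 0); split => /=; [exact: sF.1|rewrite dual0].
- move=> t w1 s1 w2 s2 _ [/= F1 ->] [/= F2 ->]; split => /=.
    by apply: sF.2 => //; exact: linear_subspaceZ.
  by rewrite dualD !dualZ.
- by have := uK w Fw; rewrite ler_norml => /andP[? _]; lra.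
exists v; split=> // b Fb; apply: le_anti; apply/andP; split; first exact: vE.
have /(vE (- b)) : E (- b, - ev u b).
  by split => /=; [exact: linear_subspaceN|rewrite dualN].
by rewrite dualN lerN2.
Qed.

(** As [F] keeps a positive distance from [x], some functional is at most -1 on F - x. Being bounded
    above on a subspace it vanishes there, and rescaling normalizes it at [x]. *)
Lemma dual_annihilator F x : linear_subspace F -> closed F -> ~ F x ->
  exists u, (forall b, F b -> ev u b = 0) /\ ev u x = 1.
Proof.
move=> sF cF nFx.
have [e e0 eF] : exists2 e : R, 0 < e & forall b, F b -> e <= `|x - b|.
  have : nbhs x (~` F) by apply: open_nbhs_nbhs; split => //; exact: closed_openC.
  move=> /nbhs_ballP[e /= e0 eF]; exists e => // b Fb.
  rewrite leNgt; apply/negP => xb; apply: (eF b) => //.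
  by rewrite -ball_normE.
pose E : set (X * R) := [set z | exists2 b, F b & z = (b - x, -1)].
have [|||w s [b Fb [-> ->]]|u [_ uE]] := @dual_sandwich e^-1 E.
- by rewrite invr_ge0 ltW.
- by exists (0 - x, -1); exists 0 => //; exact: sF.1.
- move=> t w1 s1 w2 s2 _ [b1 F1 [-> ->]] [b2 F2 [-> ->]].
  exists (t *: b1 + (1 - t) *: b2).
    by apply: sF.2 => //; exact: linear_subspaceZ.
  congr pair; last by ring.
  by rewrite !scalerBr addrACA -opprD -scalerDl addrCA subrr addr0 scale1r.
- have := eF b Fb; rewrite distrC -(ler_pM2l (x := e^-1)) ?invr_gt0//.
  by rewrite mulVf ?gt_eqF// => ?; lra.
have uF b : F b -> ev u b = 0.
  move=> Fb; have [//|ub0] := eqVneq (ev u b) 0.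
  have /uE : E ((ev u x / ev u b) *: b - x, -1).
    by exists ((ev u x / ev u b) *: b) => //; exact: linear_subspaceZ.
  by rewrite dualB dualZ divfK// subrr => ?; lra.
have ux : 0 < ev u x.
  have /uE : E (0 - x, -1) by exists 0 => //; exact: sF.1.
  by rewrite dualB dual0; lra.
exists ((ev u x)^-1 *: u); split=> [b Fb|]; rewrite dual_scaleE.
  by rewrite (uF _ Fb) mulr0.
by rewrite mulVf// gt_eqF.
Qed.

End DualSpace.

(** * Uniform boundedness on a closed subspace *)

Section UniformBoundedness.
Context {R : realType} {X : completeNormedModType R}.
Implicit Types (u : dual_space X) (b c x : X) (F : set X).

(** Without a bound, balls centred in [F] can be nested so that some member of [W] exceeds [n] in
    absolute value on a whole ball, for each [n]. The limit of the centres lies in [F] and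
    contradicts pointwise boundedness. *)
Lemma uniform_boundedness F (W : set (dual_space X)) :
  linear_subspace F -> closed F ->
  (forall b, F b -> exists C : R, forall u, W u -> `|ev u b| <= C) ->
  exists2 K : R, 0 < K & forall u b, W u -> F b -> `|ev u b| <= K * `|b|.
Proof.
move=> sF cF bW; apply: contrapT => nK.
have unbounded (K : R) : exists u b, [/\ W u, F b & K * `|b| < `|ev u b|].
  apply: contrapT => nub; apply: nK; exists (`|K| + 1); first by rewrite ltr_wpDl.
  move=> u b Wu Fb; rewrite leNgt; apply/negP => Kub; apply: nub.
  exists u, b; split=> //; apply: le_lt_trans Kub.
  by rewrite ler_wpM2r// (le_trans (ler_norm K))// lerDl.
pose P (s : X * R) := F s.1 /\ 0 < s.2.
pose Q (n : nat) (s s' : X * R) := [/\ P s', `|s'.1 - s.1| + s'.2 <= s.2,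
  s'.2 <= n.+1%:R^-1 & exists2 u, W u &
  forall x, `|x - s'.1| <= s'.2 -> n%:R < `|ev u x|].
have step (ns : nat * (X * R)) : exists s', P ns.2 -> Q ns.1 ns.2 s'.
  case: ns => n [c r] /=; have [[/= Fc r0]|nP] := pselect (P (c, r)); last first.
    by exists (c, r) => /nP.
  (* If [u] stayed bounded by [n] at the points of [F] within [r / 2] of [c], it would be bounded by
     [2 * n] on vectors of [F] of norm [r / 2], that is by [4 * n / r] per unit of norm. *)
  have [u [b [Wu Fb /= bu]]] := unbounded (4 * n%:R / r).
  have [c' [Fc' c'c uc']] : exists c',
      [/\ F c', `|c' - c| <= r / 2 & n%:R < `|ev u c'|].
    apply: contrapT => nc.
    have small c' : F c' -> `|c' - c| <= r / 2 -> `|ev u c'| <= n%:R.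
      move=> Fc' c'c; rewrite leNgt; apply/negP => lt; apply: nc; by exists c'.
    have uc := small c Fc; rewrite subrr normr0 in uc.
    have {}uc : `|ev u c| <= n%:R by apply: uc; rewrite divr_ge0// ltW.
    have b0 : 0 < `|b|.
      rewrite normr_gt0; apply: contraPneq bu => ->.
      by rewrite dual0 !normr0 mulr0 ltxx.
    have t0 : 0 < r / 2 / `|b| by rewrite !divr_gt0.
    have := small (c + (r / 2 / `|b|) *: b).
    rewrite addrAC subrr add0r normrZ gtr0_norm// divfK ?gt_eqF// lexx.
    have Fcb : F (c + (r / 2 / `|b|) *: b).
      by apply: linear_subspaceD => //; exact: linear_subspaceZ.
    move=> /(_ Fcb isT); rewrite dualD => ucb.
    have : `|ev u ((r / 2 / `|b|) *: b)| <= 2 * n%:R.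
      have := ler_normB (ev u c + ev u ((r / 2 / `|b|) *: b)) (ev u c).
      by rewrite addrAC subrr add0r; lra.
    rewrite dualZ normrM gtr0_norm// -ler_pdivlMl// leNgt => /negP; apply.
    apply: le_lt_trans bu; rewrite le_eqVlt; apply/orP; left; apply/eqP.
    by field; rewrite !gt_eqF.
  have [K K0 uK] := dual_bounded u.
  (* Half of the excess over [n], divided by a Lipschitz constant of [u]: the value stays above [n]
     on a ball of radius [d]. *)
  pose d := (`|ev u c'| - n%:R) / (2 * K).
  have d0 : 0 < d by rewrite divr_gt0 ?subr_gt0 ?mulr_gt0.
  pose r' := Order.min (r / 2) (Order.min d n.+1%:R^-1).
  have [r'r r'd r'n] : [/\ r' <= r / 2, r' <= d & r' <= n.+1%:R^-1].
    by split; rewrite /r' !ge_min lexx ?orbT.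
  exists (c', r') => _; split => /=.
  - by split => //=; rewrite /r' !lt_min divr_gt0//= d0 invr_gt0 ltr0n.
  - by lra.
  - by [].
  exists u => // x xc'.
  have := ler_normB (ev u x) (ev u x - ev u c'); rewrite opprB addrCA subrr addr0.
  rewrite -dualB; have := uK (x - c').
  have : K * `|x - c'| <= K * d by rewrite ler_pM2l//; lra.
  have -> : K * d = (`|ev u c'| - n%:R) / 2 by rewrite /d; field; rewrite gt_eqF.
  by lra.
have [f fP] := choice step.
pose fix s n := if n is m.+1 then f (m, s m) else (0 : X, 1 : R).
have Ps n : P (s n).
  elim: n => [|n IH /=]; first by split => /=; [exact: sF.1|].
  by have [] := fP (n, s n) IH.
have Qs n : Q n (s n) (s n.+1) by exact: (fP (n, s n) (Ps n)).
clearbody s.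
have ball_s n m : (n <= m)%N -> `|(s m).1 - (s n).1| + (s m).2 <= (s n).2.
  elim: m => [|m IH]; first by rewrite leqn0 => /eqP ->; rewrite subrr normr0 add0r.
  rewrite leq_eqVlt => /predU1P[->|]; first by rewrite subrr normr0 add0r.
  rewrite ltnS => /IH nm; have [_ mm _ _] := Qs m.
  have := ler_normD ((s m.+1).1 - (s m).1) ((s m).1 - (s n).1).
  by rewrite addrA subrK; lra.
have cvgs : cvg ((fun n => (s n).1) @ \oo).
  apply: cauchy_cvg; apply: cauchy_exP => e e0; rewrite /fmapE -ball_normE /ball_.
  have [n ne] : exists n : nat, n.+1%:R^-1 < e.
    exists (Num.truncn e^-1).
    by rewrite -ltf_pV2 ?posrE ?invr_gt0// invrK truncnS_gt.
  exists (s n.+1).1, n.+1 => // m /= nm.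
  rewrite /= distrC; have [_ _ sn _] := Qs n; have [_ sm] := Ps m.
  apply: le_lt_trans ne; apply: le_trans sn; apply: le_trans (ball_s _ _ nm).
  by rewrite lerDl ltW.
pose x := lim ((fun n => (s n).1) @ \oo).
have Fx : F x.
  by apply: (closed_cvg F cF _ x cvgs); apply: nearW => n; exact: (Ps n).1.
have xs n : `|x - (s n).1| <= (s n).2.
  apply/ler_addgt0Pr => e e0; near \oo => m.
  have xm : `|x - (s m).1| < e.
    by near: m; exact: ((cvgrPdist_lt (fun n => (s n).1) x).1 cvgs).
  have nm : (n <= m)%N by near: m; exact: nbhs_infty_ge.
  have := ler_distD (s m).1 x (s n).1; have := ball_s _ _ nm; have [_] := Ps m.
  by lra.
have [C WC] := bW x Fx.
have [_ _ _ [u Wu /(_ x (xs _))]] := Qs (Num.truncn C).+1.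
apply/negP; rewrite -leNgt (le_trans (WC u Wu))//.
by rewrite ltW// (lt_le_trans (truncnS_gt C)).
Unshelve. all: by end_near. Qed.

End UniformBoundedness.

(** * Affine hulls and the Fitzpatrick function *)

Section AffineSets.
Context {R : realType} {X : normedModType R}.
Implicit Types (A S : set X) (x y w : X).

Lemma affine_set_aff S : affine_set (aff S).
Proof. by move=> x y t xS yS B SB; apply: SB.1; [exact: xS|exact: yS]. Qed.

Lemma subset_aff S : S `<=` aff S.
Proof. by move=> x Sx B [_ SB]; exact: SB. Qed.

Lemma aff_sub S A : affine_set A -> S `<=` A -> aff S `<=` A.
Proof. by move=> affA SA x; apply. Qed.

(** The subspace parallel to [A]. One base point is enough, since [affine_setD] passes to any
    other. *)
Definition direction A : set X := [set w | exists2 a, A a & A (a + w)].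

Lemma affine_setD A x w : affine_set A -> A x -> direction A w -> A (x + w).
Proof.
move=> affA Ax [a Aa Aaw].
(* [x + w] is 2m - a, where m is the midpoint of [x] and [a + w]. *)
have := affA _ _ 2 Aa (affA _ _ 2^-1 Ax Aaw).
rewrite scalerDr !scalerA divff ?pnatr_eq0// scale1r.
have -> : 2 * (1 - 2^-1) = 1 :> R by lra.
have -> : 1 - 2 = -1 :> R by lra.
by rewrite scaleN1r !scale1r addrCA addKr.
Qed.

Lemma directionB A x y : A x -> A y -> direction A (y - x).
Proof. by move=> Ax Ay; exists x => //; rewrite addrC subrK. Qed.

Lemma direction_subspace A :
  affine_set A -> A !=set0 -> linear_subspace (direction A).
Proof.
move=> affA [a Aa]; split=> [|t x y Fx Fy]; first by exists a => //; rewrite addr0.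
exists a => //; rewrite addrA; apply: affine_setD => //.
have := affA _ _ t Aa (affine_setD affA Aa Fx).
by rewrite scalerDr addrA -scalerDl subrK scale1r.
Qed.

Lemma direction_closed A : affine_set A -> closed A -> closed (direction A).
Proof.
move=> affA cA; have [[a Aa]|A0] := pselect (A !=set0); last first.
  rewrite (_ : direction A = set0); first exact: closed0.
  by rewrite -subset0 => w [a Aa _]; apply: A0; exists a.
have -> : direction A = (fun w => a + w) @^-1` A.
  apply/seteqP; split=> [w Fw|w Aw]; first exact: affine_setD.
  by exists a.
apply: closed_comp cA => w _.
by apply: cvgD; [exact: cvg_cst|exact: cvg_id].
Qed.

Lemma subspace_interiorP (S B : set X) x : B x ->
  (S : set (subspace B))° x <->
  exists2 e : R, 0 < e & forall y, B y -> `|x - y| < e -> S y.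
Proof.
move=> Bx; rewrite /interior.
have -> : nbhs (x : subspace B) S = within B (nbhs x) S.
  by rewrite (nbhs_subspace_in Bx).
rewrite /within /=; split.
  move=> /nbhs_ballP[e /= e0 eS]; exists e => // y By xy.
  by apply: eS => //; rewrite -ball_normE.
move=> [e e0 eS]; apply/nbhs_ballP; exists e => //= y.
by rewrite -ball_normE /= => xy By; exact: eS.
Qed.

End AffineSets.

(** * The Fitzpatrick inequality around a point *)

Section Fitzpatrick.
Context {R : realType} {X : normedModType R}.
Variable T : X -> set (dual_space X).
Implicit Types (u v : dual_space X) (a b c w x y : X) (p r s t : R).
Local Notation D := (domain T).
Local Notation A := (aff D).
Local Notation F := (direction A).

Lemma monotone_ge0 x y u v : monotone_multi T -> T x u -> T y v ->
  0 <= ev (u - v) (x - y).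
Proof. by move=> mT Txu Tyv; exact: (mT x y u v). Qed.

(** Otherwise adjoining [(x, u)] to the graph would give a proper monotone extension. *)
Lemma maximal_monotone_mem x u : maximal_monotone T ->
  (forall y v, T y v -> 0 <= ev (u - v) (x - y)) -> T x u.
Proof.
move=> [mT maxT] mr; apply: contrapT => nTxu; apply: maxT.
exists (fun y => [set v | T y v \/ y = x /\ v = u]); last first.
  split=> [[y v] Tyv|ST]; first by left.
  by apply: nTxu; apply: (ST (x, u)); right.
move=> x1 x2 u1 u2; rewrite /graph /= => -[T1|[-> ->]] [T2|[-> ->]].
- exact: mT.
- have := mr _ _ T1; rewrite dual_subE !dualB => ?.
  change (0 <= ev (u1 - u) (x1 - x)); rewrite dual_subE !dualB; lra.
- exact: mr.
- by change (0 <= ev (u - u) (x - x)); rewrite dual_subE subrr.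
Qed.

Lemma aff_domain x u : T x u -> A x.
Proof. by move=> Txu; apply: subset_aff; exists u. Qed.

(* The epigraph of the Fitzpatrick function of [T], restricted to [aff D(T)]. *)
Definition fitz_epi a u p :=
  A a /\ forall b v, T b v -> ev u b + ev v a - p <= ev v b.

Lemma fitz_epi_graph a u : monotone_multi T -> T a u -> fitz_epi a u (ev u a).
Proof.
move=> mT Tau; split=> [|b v Tbv]; first exact: aff_domain Tau.
by have := monotone_ge0 mT Tau Tbv; rewrite dual_subE !dualB; lra.
Qed.

(** If [p < ev u a], the epigraph inequalities make [(a, u)] monotonically related to [T], hence a
    member; the inequality at [(a, u)] itself then fails. *)
Lemma fitz_epi_ge a u p : maximal_monotone T -> fitz_epi a u p -> ev u a <= p.
Proof.
move=> maxT [Aa epi]; rewrite leNgt; apply/negP => pu.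
have Tau : T a u.
  apply: maximal_monotone_mem => // b v Tbv.
  by have := epi _ _ Tbv; rewrite dual_subE !dualB; lra.
by have := epi _ _ Tau; lra.
Qed.

(* For r > 0 this expresses that x is interior, relative to [aff D(T)], to the
   projection on X of the domain of the Fitzpatrick function. *)
Definition fitz_ball x r := exists M : R, forall a u p, fitz_epi a u p ->
  forall b, F b -> `|b| <= r -> ev u b <= p - ev u x + M * (1 + `|a|).

(** With radius 0 only [b = 0] remains, and the epigraph inequality at the single pair [(x, u)]
    suffices, because [ev u a] is at least -K|a|. *)
Lemma fitz_ball_domain x u : T x u -> fitz_ball x 0.
Proof.
move=> Txu; have [K K0 uK] := dual_bounded u.
exists (K + `|ev u x|) => a v p [_ epi] b _; rewrite normr_le0 => /eqP ->.
rewrite dual0; have := epi _ _ Txu; have := uK a; rewrite ler_norml => /andP[? _].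
have := ler_norm (ev u x); have := normr_ge0 (ev u x); have := normr_ge0 a => *.
have : 0 <= `|ev u x| * `|a| by rewrite mulr_ge0.
nra.
Qed.

Lemma fitz_ball_shift x r w : linear_subspace F -> F w ->
  fitz_ball x r -> fitz_ball (x + w) (r - `|w|).
Proof.
move=> sF Fw [M xM]; exists M => a u p epi b Fb br.
have := xM a u p epi (b + w) (linear_subspaceD sF Fb Fw).
have bw : `|b + w| <= r by have := ler_normD b w; lra.
by move=> /(_ bw); rewrite !dualD; lra.
Qed.

(** Add the inequality at [x] for 0 and the one at [y] for [t^-1 *: b], with weights [1 - t] and
    [t]. *)
Lemma fitz_ball_conv x y r t : linear_subspace F -> 0 < t <= 1 ->
  fitz_ball x 0 -> fitz_ball y r -> fitz_ball ((1 - t) *: x + t *: y) (t * r).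
Proof.
move=> sF /andP[t0 t1] [M xM] [M' yM]; exists ((1 - t) * M + t * M').
move=> a u p epi b Fb br.
have bt : `|t^-1 *: b| <= r.
  by rewrite normrZ gtr0_norm ?invr_gt0// ler_pdivrMl.
have := yM a u p epi (t^-1 *: b) (linear_subspaceZ _ sF Fb) bt.
have := xM a u p epi 0 sF.1; rewrite normr0 lexx dual0 => /(_ isT).
rewrite dualD !dualZ => xle yle.
have {}yle : ev u b <= t * (p - ev u y + M' * (1 + `|a|)).
  by rewrite -ler_pdivrMl.
have {}xle : 0 <= (1 - t) * (p - ev u x + M * (1 + `|a|)).
  by rewrite mulr_ge0// subr_ge0.
lra.
Qed.

(** A functional v with v(a - x) <= p - u(x) on the whole epigraph is monotonically related to [T]
    at [x]: take p = u(a) at graph points. Hahn-Banach provides it once p - u(x) >= -K|a - x|. *)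
Lemma fitz_ball_mem x r : maximal_monotone T -> D !=set0 ->
  A x -> 0 < r -> fitz_ball x r -> D x.
Proof.
move=> maxT [d [v0 Tdv0]] Ax r0 [M xM].
have sF : linear_subspace F.
  by apply: direction_subspace; [exact: affine_set_aff|exists x].
pose E : set (X * R) :=
  [set z | exists a u p, fitz_epi a u p /\ z = (a - x, p - ev u x)].
(* Chosen so that M(1 + |a|) is at most M'(1 + |a - x|). *)
pose M' := `|M| * (1 + `|x|).
have M'0 : 0 <= M' by rewrite mulr_ge0// addr_ge0.
(* The first term serves when |a - x| <= 1, tested along the opposite vector of norm [r]; the second
   serves for larger norms, tested at [b = 0]. *)
pose K := 2 * M' / r + 2 * M'.
have K0 : 0 <= K by rewrite addr_ge0 ?divr_ge0 ?mulr_ge0// ltW.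
have [|||v [_ vE]] := @dual_sandwich R X K E K0.
- exists (d - x, ev v0 d - ev v0 x); exists d, v0, (ev v0 d); split=> //.
  exact: fitz_epi_graph maxT.1 Tdv0.
- move=> t w1 s1 w2 s2 /andP[t0 t1] [a1 [u1 [p1 [[A1 e1] [-> ->]]]]].
  move=> [a2 [u2 [p2 [[A2 e2] [-> ->]]]]].
  exists (t *: a1 + (1 - t) *: a2), (t *: u1 + (1 - t) *: u2),
    (t * p1 + (1 - t) * p2); split; last first.
    rewrite dual_addE !dual_scaleE !scalerBr; congr pair; last by ring.
    by rewrite addrACA -opprD -scalerDl addrCA subrr addr0 scale1r.
  split=> [|b v Tbv].
    have := affine_set_aff (1 - t) A1 A2; by rewrite subKr.
  rewrite dual_addE !dual_scaleE dualD !dualZ.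
  have := e1 _ _ Tbv; have := e2 _ _ Tbv => h2 h1.
  have : t * (ev u1 b + ev v a1 - p1) <= t * ev v b by rewrite ler_wpM2l.
  have : (1 - t) * (ev u2 b + ev v a2 - p2) <= (1 - t) * ev v b.
    by rewrite ler_wpM2l// subr_ge0.
  lra.
- move=> w' s' [a [u [p [epi [-> ->]]]]] {w' s'}.
  have pu := fitz_epi_ge maxT epi.
  have Fax : F (a - x) by apply: directionB => //; exact: epi.1.
  set w := a - x in Fax *; set s := p - ev u x.
  have sw : ev u w <= s by rewrite dualB; rewrite /s; lra.
  have Mw : M * (1 + `|a|) <= M' * (1 + `|w|).
    have : `|a| <= `|x| + `|w|.
      by rewrite -[X in `|X| <= _](subrK x) addrC ler_normD.
    have := ler_norm M; have := normr_ge0 M; have := normr_ge0 a.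
    have := normr_ge0 x; have := normr_ge0 w; rewrite /M' => *.
    apply: (@le_trans _ _ (`|M| * (1 + `|a|))).
      by rewrite ler_wpM2r// addr_ge0.
    rewrite -mulrA ler_wpM2l// mulrDl mul1r.
    have : 0 <= `|x| * `|w| by rewrite mulr_ge0.
    lra.
  have [w0|w0] := eqVneq w 0.
    by move: sw; rewrite w0 dual0 normr0 mulr0 addr0.
  have nw : 0 < `|w| by rewrite normr_gt0.
  have [s0|s0] := leP 0 s; first by rewrite addr_ge0// mulr_ge0.
  have [w1|w1] := leP `|w| 1.
    have := xM a u p epi (- (r / `|w|) *: w) (linear_subspaceZ _ sF Fax).
    rewrite normrZ normrN gtr0_norm ?divr_gt0// divfK ?gt_eqF// lexx dualZ.
    move=> /(_ isT) h.
    have {}h : - ev u w * (r / `|w|) <= 2 * M'.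
      have : M' * (1 + `|w|) <= M' * 2 by rewrite ler_wpM2l//; lra.
      by rewrite -/s in h; lra.
    have : - ev u w <= 2 * M' / r * `|w|.
      rewrite -ler_pdivlMr ?divr_gt0// in h; apply: le_trans h _.
      by rewrite invf_div mulrA mulrAC.
    have : 0 <= M' * `|w| by rewrite mulr_ge0.
    by rewrite /K; lra.
  have := xM a u p epi 0 sF.1; rewrite normr0 (ltW r0) dual0 => /(_ isT) h.
  have : M' * (1 + `|w|) <= M' * (2 * `|w|) by rewrite ler_wpM2l//; lra.
  have : 0 <= 2 * M' / r * `|w| by rewrite mulr_ge0// divr_ge0 ?mulr_ge0// ltW.
  by rewrite -/s in h; rewrite /K; lra.
exists v; apply: maximal_monotone_mem => // a u Tau.
have : E (a - x, ev u a - ev u x).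
  exists a, u, (ev u a); split=> //; exact: fitz_epi_graph maxT.1 Tau.
by move=> /vE; rewrite dual_subE !dualB; lra.
Qed.

End Fitzpatrick.

(** * The domain of a maximal monotone operator *)

Section MonotoneDomain.
Context {R : realType} {X : completeNormedModType R}.
Variable T : X -> set (dual_space X).
Implicit Types (u v : dual_space X) (a b c w x y : X) (p r s t : R).
Local Notation D := (domain T).
Local Notation A := (aff D).
Local Notation F := (direction A).

(* The functionals u / N, with (a, u, p) in the epigraph of the Fitzpatrick
   function and N = p - u(x) + M (1 + |a|), are pointwise bounded on F. *)
Lemma rel_alg_int_fitz_ball x : closed A -> rel_alg_int D x ->
  exists2 r, 0 < r & fitz_ball T x r.
Proof.
move=> cA [[v0 Txv0] xD].
have Ax : A x := aff_domain Txv0.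
have sF : linear_subspace F.
  by apply: direction_subspace; [exact: affine_set_aff|exists x].
have cF : closed F by apply: direction_closed => //; exact: affine_set_aff.
have [M xM] := fitz_ball_domain Txv0.
(* The 1 added to [M] makes [N a u p] at least 1 + |a|, hence positive. *)
pose N a u p := p - ev u x + (M + 1) * (1 + `|a|).
have N_ge a u p : fitz_epi T a u p -> 1 + `|a| <= N a u p.
  move=> /xM/(_ 0 sF.1); rewrite normr0 lexx dual0 => /(_ isT).
  by rewrite /N; lra.
have N_gt0 a u p : fitz_epi T a u p -> 0 < N a u p.
  by move=> /N_ge; apply: lt_le_trans; rewrite ltr_pwDl.
(* Some [x + rho *: b] with [rho > 0] lies in D(T); the epigraph inequality at a pair over that
   point bounds [ev u b] from above. *)
have one_sided b : F b -> exists C : R, forall a u p, fitz_epi T a u p ->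
    ev u b <= C * N a u p.
  move=> Fb; have [rho rho0] := xD _ (affine_setD (@affine_set_aff _ _ D) Ax Fb).
  move=> /(_ rho); rewrite (ltW rho0) lexx => /(_ isT).
  rewrite scalerDr addrA -scalerDl subrK scale1r => -[v Tv].
  have [K K0 vK] := dual_bounded v.
  pose C := K + `|ev v (x + rho *: b)|.
  exists (rho^-1 * (1 + `|C - M - 1|)) => a u p epi.
  rewrite -mulrA ler_pdivlMl//.
  have := epi.2 _ _ Tv; rewrite (dualD u) dualZ => h.
  have h1 : rho * ev u b <= p - ev u x + C * (1 + `|a|).
    have := vK a; rewrite ler_norml => /andP[? _].
    have := ler_norm (ev v (x + rho *: b)).
    have := normr_ge0 (ev v (x + rho *: b)); have := normr_ge0 a => *.
    have : 0 <= `|ev v (x + rho *: b)| * `|a| by rewrite mulr_ge0.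
    by rewrite /C; lra.
  have h2 : (C - M - 1) * (1 + `|a|) <= `|C - M - 1| * N a u p.
    apply: (@le_trans _ _ (`|C - M - 1| * (1 + `|a|))).
      by rewrite ler_wpM2r ?ler_norm// addr_ge0.
    by rewrite ler_wpM2l// N_ge.
  by apply: (le_trans h1); move: h2; rewrite /N; lra.
pose W := [set v | exists a u p, fitz_epi T a u p /\ v = (N a u p)^-1 *: u].
have [b Fb|K K0 WK] := @uniform_boundedness _ _ F W sF cF.
  have [C1 h1] := one_sided b Fb.
  have [C2 h2] := one_sided (- b) (linear_subspaceN sF Fb).
  exists (Order.max C1 C2) => _ [a [u [p [epi ->]]]].
  rewrite dual_scaleE ler_norml; apply/andP; split.
    rewrite lerNl -mulrN -dualN ler_pdivrMl ?N_gt0// mulrC.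
    apply: (le_trans (h2 _ _ _ epi)); rewrite ler_wpM2r ?(ltW (N_gt0 _ _ _ epi))//.
    by rewrite le_max lexx orbT.
  rewrite ler_pdivrMl ?N_gt0// mulrC.
  apply: (le_trans (h1 _ _ _ epi)); rewrite ler_wpM2r ?(ltW (N_gt0 _ _ _ epi))//.
  by rewrite le_max lexx.
exists K^-1; first by rewrite invr_gt0.
exists (M + 1) => a u p epi b Fb bK.
have := WK ((N a u p)^-1 *: u) b; rewrite dual_scaleE.
have Wu : W ((N a u p)^-1 *: u) by exists a, u, p.
move=> /(_ Wu Fb); rewrite ler_norml => /andP[_].
rewrite ler_pdivrMl ?N_gt0// => /le_trans; apply.
rewrite -/(N a u p) -[leRHS]mulr1 ler_wpM2l ?(ltW (N_gt0 _ _ _ epi))//.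
by rewrite -(@ler_pM2l _ K^-1) ?invr_gt0// mulrA mulVf ?gt_eqF// mul1r mulr1.
Qed.

(** * Relative interior, near convexity and supporting functionals *)

Section Maximal.
Hypotheses (maxT : maximal_monotone T) (cA : closed A) (D0 : D !=set0).

Let affA : affine_set A := @affine_set_aff _ _ D.

Let sF : linear_subspace F.
Proof.
by apply: direction_subspace => //; case: D0 => x Dx; exists x; exact: subset_aff.
Qed.

Let cE : closure A = A.
Proof. exact/esym/closure_id. Qed.

(** From right to left, the estimate persists with a smaller radius at each [x + b] with [b] in [F]
    and |b| < r, so all these points lie in D(T). *)
Lemma ic_domainE : ic D = [set x | A x /\ exists2 r, 0 < r & fitz_ball T x r].
Proof.
rewrite /ic asboolT//; apply/seteqP; split=> x.
  move=> xD; split; last exact: rel_alg_int_fitz_ball.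
  by apply: subset_aff; case: xD.
move=> [Ax [r r0 xr]].
have ballD b : F b -> `|b| < r -> D (x + b).
  move=> Fb br; apply: (@fitz_ball_mem _ _ _ _ (r - `|b|)) => //.
  - exact: affine_setD.
  - by rewrite subr_gt0.
  - exact: fitz_ball_shift.
split; first by have := ballD 0 sF.1; rewrite normr0 addr0 => /(_ r0).
move=> y Ay; exists (r / (1 + `|y - x|)); first by rewrite divr_gt0// ltr_pwDl.
move=> l /andP[l0 lr].
have -> : (1 - l) *: x + l *: y = x + l *: (y - x).
  by rewrite scalerBl scale1r scalerBr addrAC addrA.
apply: ballD; first by apply: linear_subspaceZ => //; exact: directionB.
rewrite normrZ ger0_norm//; move: lr; rewrite ler_pdivlMr ?ltr_pwDl//.
have [->|ln0] := eqVneq l 0; first by rewrite !mul0r.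
have : 0 < l by rewrite lt_neqAle eq_sym ln0.
lra.
Qed.

Lemma ic_domain_sub : ic D `<=` D.
Proof. by rewrite /ic asboolT// => x []. Qed.

Lemma ic_domain_ball x : ic D x ->
  exists2 r, 0 < r & forall y, A y -> `|x - y| < r -> ic D y.
Proof.
rewrite ic_domainE => -[Ax [r r0 xr]]; exists r => // y Ay xy; split=> //.
exists (r - `|y - x|); first by rewrite subr_gt0 distrC.
have := @fitz_ball_shift _ _ T x r (y - x) sF.
by rewrite [x + _]addrC subrK; apply => //; exact: directionB.
Qed.

(** Radius 0 is enough at [x], which may thus be any point of D(T), even outside [ic D]. *)
Lemma ic_domain_conv x y t : A x -> fitz_ball T x 0 -> ic D y -> 0 < t <= 1 ->
  ic D ((1 - t) *: x + t *: y).
Proof.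
rewrite ic_domainE => Ax x0 [Ay [r r0 yr]] t01; split; first exact: affA.
exists (t * r); first by case/andP: t01 => t0 _; rewrite mulr_gt0.
exact: fitz_ball_conv.
Qed.

Lemma ic_domain_ri : ic D = ri D.
Proof.
apply/seteqP; split=> x.
  move=> icx; have Ax : A x by apply: subset_aff; exact: ic_domain_sub.
  rewrite /ri cE; apply/subspace_interiorP => //.
  have [r r0 xr] := ic_domain_ball icx; exists r => // y Ay xy.
  exact: ic_domain_sub (xr _ Ay xy).
rewrite /ri cE => xD.
have Dx : D x by apply: interior_subset xD.
have Ax : A x by exact: subset_aff.
move: xD => /(subspace_interiorP _ Ax)[e e0 eD].
rewrite /ic asboolT//; split=> // y Ay.
exists (e / (2 * (1 + `|y - x|))).
  by rewrite divr_gt0// mulr_gt0// ltr_pwDl.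
move=> l /andP[l0 lr].
apply: eD; first exact: affA.
have -> : x - ((1 - l) *: x + l *: y) = l *: (x - y).
  by rewrite scalerBl scale1r scalerBr opprD opprB addrA addrCA subrr addr0.
rewrite normrZ ger0_norm// distrC; move: lr.
rewrite ler_pdivlMr ?mulr_gt0 ?ltr_pwDl//.
have : 0 <= l * `|y - x| by rewrite mulr_ge0.
lra.
Qed.

Lemma closure_ic_domain : ic D !=set0 -> D `<=` closure (ic D).
Proof.
move=> [y icy] x [u Txu] B /nbhs_ballP[e /= e0 eB].
have Ax := aff_domain Txu.
pose t := Order.min 1 (e / (2 * (1 + `|x - y|))).
have d0 : 0 < 2 * (1 + `|x - y|) by rewrite mulr_gt0// ltr_pwDl.
have t0 : 0 < t by rewrite lt_min ltr01 divr_gt0.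
have t1 : t <= 1 by rewrite ge_min lexx.
have te : t * (2 * (1 + `|x - y|)) <= e.
  by rewrite -ler_pdivlMr// ge_min lexx orbT.
exists ((1 - t) *: x + t *: y); split.
  by apply: ic_domain_conv => //; [exact: fitz_ball_domain Txu|rewrite t0].
apply: eB; rewrite -ball_normE /ball_ /=.
have -> : x - ((1 - t) *: x + t *: y) = t *: (x - y).
  by rewrite scalerBl scale1r scalerBr opprD opprB addrA addrCA subrr addr0.
rewrite normrZ gtr0_norm//.
have : 0 <= t * `|x - y| by rewrite mulr_ge0// ltW.
lra.
Qed.

Lemma nearly_convex_domain : ic D !=set0 -> nearly_convex D.
Proof.
move=> ic0; exists (ic D); split=> //.
- move=> x y l; rewrite !inE => icx icy.
  change (ic D (l%:num *: x + (1 - l%:num) *: y)).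
  (* [ic_domain_conv] needs a positive weight on its second point. *)
  have [->|l1] := eqVneq (l%:num) 1.
    by rewrite subrr scale1r scale0r addr0.
  have l01 : 0 < 1 - l%:num <= 1.
    by rewrite subr_gt0 lt_neqAle l1 le1/= gerBl ge0.
  rewrite -[X in X *: x](subKr 1); apply: ic_domain_conv => //.
    by apply: subset_aff; exact: ic_domain_sub.
  by have [v Txv] := ic_domain_sub icx; exact: fitz_ball_domain Txv.
- have [y icy] := ic0; exists y; rewrite /ri.
  have affIA : closure (aff (ic D)) `<=` A.
    rewrite -[X in _ `<=` X]cE; apply: closure_subset; apply: aff_sub => //.
    by move=> x /ic_domain_sub; exact: subset_aff.
  apply/subspace_interiorP; first by apply: subset_closure; exact: subset_aff.
  have [r r0 yr] := ic_domain_ball icy; exists r => // x /affIA; exact: yr.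
- exact: ic_domain_sub.
- exact: closure_ic_domain.
Qed.

(** The separation could fail only if some c - x + l(y - x) had norm less than l r. Then [x] would
    be a convex combination of c and a point of [ic D] near [y], hence itself in [ic D]. *)
Lemma support_functional x y : D x -> ~ ic D x -> ic D y -> exists u,
  (forall c, D c -> ev u (c - x) <= 0) /\ ev u (y - x) <= -1.
Proof.
move=> Dx nicx icy; have Ax : A x by exact: subset_aff.
have Ay : A y by apply: subset_aff; exact: ic_domain_sub.
have [r r0 yr] := ic_domain_ball icy.
pose C := [set c | A c /\ fitz_ball T c 0].
pose E : set (X * R) := [set z | exists l c, [/\ 0 <= l, C c &
  z = (c - x + l *: (y - x), - l)]].
have DC c : D c -> C c.
  by move=> [v Tcv]; split; [exact: aff_domain Tcv|exact: fitz_ball_domain Tcv].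
have [|||w s [l [c [l0 [Ac c0] [-> ->]]]]|u [_ uE]] := @dual_sandwich R X r^-1 E.
- by rewrite invr_ge0 ltW.
- by eexists; exists 0, x; split; [exact: lexx|exact: DC|].
- move=> t w1 s1 w2 s2 t01 [l1 [c1 [l10 [Ac1 c10] [-> ->]]]].
  move=> [l2 [c2 [l20 [Ac2 c20] [-> ->]]]].
  exists (t * l1 + (1 - t) * l2), (t *: c1 + (1 - t) *: c2).
  case/andP: t01 => t0 t1; split.
  - by rewrite addr_ge0// mulr_ge0// subr_ge0.
  - have [->|tn1] := eqVneq t 1; first by rewrite subrr scale1r scale0r addr0.
    have {}t1 : 0 < 1 - t <= 1 by rewrite subr_gt0 lt_neqAle tn1 t1 gerBl.
    have := affA (1 - t) Ac1 Ac2; have := fitz_ball_conv sF t1 c10 c20.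
    by rewrite subKr mulr0.
  - congr pair; last by ring.
    move: (y - x) => h; rewrite !scalerDr !scalerA addrACA -scalerDl.
    congr (_ + _).
    by rewrite !scalerN addrACA -opprD -scalerDl [t + _]addrC subrK scale1r.
- set e := c - x + l *: (y - x).
  suff : l * r <= `|e| by rewrite mulrC -ler_pdivlMl//; lra.
  rewrite leNgt; apply/negP => elr.
  have {l0} l0 : 0 < l.
    by move: elr; rewrite -(pmulr_lgt0 _ r0); apply: le_lt_trans.
  have Fe : F (l^-1 *: e).
    apply: linear_subspaceZ => //; apply: linear_subspaceD => //.
      exact: directionB.
    by apply: linear_subspaceZ => //; exact: directionB.
  apply: nicx; have l1 : 0 < 1 + l by rewrite addr_gt0.
  have -> : x = (1 - l / (1 + l)) *: c + (l / (1 + l)) *: (y - l^-1 *: e).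
    rewrite scalerBr scalerA mulrAC mulfV ?gt_eqF// mul1r.
    have -> : 1 - l / (1 + l) = (1 + l)^-1 by field; rewrite gt_eqF.
    rewrite mulrC -scalerA -!scalerBr -!scalerDr.
    have -> : c + (l *: y - e) = (1 + l) *: x.
      rewrite /e scalerBr opprD !opprB addrA addrACA [c + _]addrC subrK.
      by rewrite [l *: y + _]addrC subrK scalerDl scale1r.
    by rewrite scalerA mulVf ?scale1r// gt_eqF.
  apply: ic_domain_conv => //.
    apply: yr; first by apply: affine_setD => //; exact: linear_subspaceN.
    by rewrite opprB addrC subrK normrZ gtr0_norm ?invr_gt0// ltr_pdivrMl.
  by rewrite divr_gt0//= ler_pdivrMr// mul1r lerDr.
exists u; split=> [c Dc|].
  have /uE : E (c - x + 0 *: (y - x), - 0).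
    by exists 0, c; split => //; exact: DC.
  by rewrite scale0r addr0 oppr0.
have /uE : E (x - x + 1 *: (y - x), - 1).
  by exists 1, x; split => //; exact: DC.
by rewrite subrr add0r scale1r.
Qed.

End Maximal.
End MonotoneDomain.

(** * Necessity of the conditions *)

Section WeakStar.
Context {R : realType} {X : normedModType R}.

Lemma weak_star_ev_continuous (b : X) :
  continuous (fun u : weak_star X => ev u b : R^o).
Proof.
move=> u.
apply: (@continuous_comp (weak_star X) {ptws X -> R^o} R^o
  (fun v : dual_space X => (v : {ptws X -> R^o})) (fun g => g b)).
  exact: initial_continuous.
exact: (@proj_continuous X (fun=> R^o) b).
Qed.

End WeakStar.

(** * The Fitzpatrick function as a representing function *)

Section Representable.
Context {R : realType} {X : normedModType R}.
Variable T : X -> set (dual_space X).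
Implicit Types (u v : dual_space X) (b c w x y : X) (z : X * dual_space X).

Lemma maximal_monotone_normal_cone (C : set X) :
  maximal_monotone T -> domain T `<=` C -> T = multi_add T (normal_cone C).
Proof.
move=> maxT DC; apply/funext => x; apply/seteqP; split=> [u Txu|_ [u Txu [v [Cx vC] ->]]].
  exists u => //; exists 0; last by rewrite addr0.
  by split=> //; apply: DC; exists u.
apply: maximal_monotone_mem => // b w Tbw.
have : ev v (b - x) <= 0 by apply: vC; apply: DC; exists w.
have := monotone_ge0 maxT.1 Txu Tbw.
by rewrite !dual_subE dual_addE !dualB; lra.
Qed.

(** A supremum of functions that are affine and continuous for the norm and weak-star topologies;
    convexity and lower semicontinuity rest on this. *)
Definition fitzpatrick z : \bar R := ereal_sup
  [set (ev z.2 bv.1 + ev bv.2 z.1 - ev bv.2 bv.1)%:E | bv in graph T].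

Lemma fitzpatrick_ub z b v : T b v ->
  ((ev z.2 b + ev v z.1 - ev v b)%:E <= fitzpatrick z)%E.
Proof. by move=> Tbv; apply: ereal_sup_ubound; exists (b, v). Qed.

Lemma fitzpatrick_convex : convex_efun fitzpatrick.
Proof.
move=> t z w; apply: ge_ereal_sup => _ [[b v] Tbv <-] /=.
have t0 : 0 <= t%:num by [].
have t1 : 0 <= 1 - t%:num by rewrite subr_ge0.
apply: (@le_trans _ _ (t%:num%:E * (ev z.2 b + ev v z.1 - ev v b)%:E +
  (1 - t%:num)%:E * (ev w.2 b + ev v w.1 - ev v b)%:E)%E).
  rewrite -!EFinM -EFinD lee_fin.
  change (ev (t%:num *: z.2 + (1 - t%:num) *: w.2) b +
    ev v (t%:num *: z.1 + (1 - t%:num) *: w.1) - ev v b <=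
    t%:num * (ev z.2 b + ev v z.1 - ev v b) +
    (1 - t%:num) * (ev w.2 b + ev v w.1 - ev v b)).
  by rewrite dual_addE !dual_scaleE dualD !dualZ; lra.
by apply: leeD; apply: lee_wpmul2l; rewrite ?lee_fin//; exact: fitzpatrick_ub.
Qed.

Lemma fitzpatrick_lsc :
  lower_semicontinuous (fitzpatrick : X * weak_star X -> \bar R).
Proof.
move=> [x u] a /ereal_sup_gt[_ [[b v] Tbv <-]] /=; rewrite lte_fin => ab.
pose e := (ev u b + ev v x - ev v b - a) / 2.
have e0 : 0 < e by rewrite divr_gt0// subr_gt0.
have e2 : 2 * e = ev u b + ev v x - ev v b - a by rewrite /e; lra.
exists [set z | `|ev v x - ev v z.1| < e /\ `|ev u b - ev z.2 b| < e].
  exists ([set y | `|ev v x - ev v y| < e],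
    [set w : weak_star X | `|ev u b - ev w b| < e]) => //=; split.
    by apply: (cvgrPdist_lt (v : X -> R^o) (v x)).1 => //; exact: dual_continuous.
  by have /cvgrPdist_lt/(_ _ e0) := @weak_star_ev_continuous _ _ b u.
move=> [y w] /= [vy wb]; apply: lt_le_trans (fitzpatrick_ub (y, w) Tbv).
rewrite lte_fin /=; move: vy wb; rewrite !ltr_norml => /andP[_ ?] /andP[_ ?].
lra.
Qed.

(** On [T] the Fitzpatrick function equals the pairing. Where it does not exceed the pairing, the
    pair is monotonically related to [T], so maximality puts it in [T]. *)
Lemma maximal_monotone_representable :
  maximal_monotone T -> domain T !=set0 -> representable T.
Proof.
move=> maxT [d [v0 Tdv0]].
have fE x u : T x u -> fitzpatrick (x, u) = (ev u x)%:E.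
  move=> Txu; apply: le_anti; apply/andP; split; last first.
    have := fitzpatrick_ub (x, u) Txu; apply: le_trans.
    by rewrite lee_fin /=; lra.
  apply: ge_ereal_sup => _ [[b v] Tbv <-] /=; rewrite lee_fin.
  by have := monotone_ge0 maxT.1 Txu Tbv; rewrite dual_subE !dualB; lra.
have fmem x u : (fitzpatrick (x, u) <= (ev u x)%:E)%E -> T x u.
  move=> fxu; apply: maximal_monotone_mem => // b v Tbv.
  have := le_trans (fitzpatrick_ub (x, u) Tbv) fxu.
  by rewrite lee_fin dual_subE !dualB /=; lra.
exists fitzpatrick; split.
- split=> [z|].
    have := fitzpatrick_ub z Tdv0.
    by case: (fitzpatrick z).
  by exists (d, v0); rewrite (fE d v0).
- exact: fitzpatrick_convex.
- exact: fitzpatrick_lsc.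
- move=> x u; rewrite leNgt; apply/negP => lt.
  by move: (lt); rewrite fE ?ltxx//; exact: fmem (ltW lt).
- apply/seteqP; split=> [[x u] /fE//|[x u] /= fxu].
  by apply: fmem; rewrite fxu.
Qed.

End Representable.

Section BoundaryGrowth.
Context {R : realType} {X : completeNormedModType R}.
Variable T : X -> set (dual_space X).

(** Adding nonnegative multiples of a functional [u] supporting D(T) at [x] stays within [T x], and
    [ev u (x - y) >= 1]. *)
Lemma maximal_monotone_unbounded (x y : X) : maximal_monotone T ->
  closed (aff (domain T)) -> (domain T `\` ic (domain T)) x -> ic (domain T) y ->
  ereal_sup [set (u (x - y))%:E | u in T x] = +oo%E.
Proof.
move=> maxT cA [[v Txv] nicx] icy.
have D0 : domain T !=set0 by exists x, v.
have [u [uD uy]] := support_functional maxT cA D0 (ex_intro _ v Txv) nicx icy.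
have Tvu (k : R) : 0 <= k -> T x (v + k *: u).
  move=> k0; apply: maximal_monotone_mem => // b w Tbw.
  have := monotone_ge0 maxT.1 Txv Tbw.
  have : 0 <= k * - ev u (b - x).
    by rewrite mulr_ge0// oppr_ge0; apply: uD; exists w.
  by rewrite !dual_subE dual_addE !dual_scaleE !dualB; lra.
apply/eqyP => r r0.
pose k := `|r| + `|ev v (x - y)|.
have k0 : 0 <= k by rewrite addr_ge0.
apply: (@le_trans _ _ (ev (v + k *: u) (x - y))%:E); last first.
  by apply: ereal_sup_ubound; exists (v + k *: u) => //; exact: Tvu.
rewrite lee_fin dual_addE dual_scaleE.
have : k * 1 <= k * ev u (x - y).
  by rewrite ler_wpM2l// -opprB dualN; lra.
have := ler_norm r; have := ler_norm (- ev v (x - y)); rewrite normrN.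
by rewrite /k; lra.
Qed.

End BoundaryGrowth.

(** * Weak-star compactness and representable operators *)

Lemma lt_EFin_between (R : realType) (c : R) (y : \bar R) : (c%:E < y)%E ->
  exists2 r : R, c < r & (r%:E < y)%E.
Proof.
case: y => [y| |] //; last by exists (c + 1); rewrite ?ltry// ltrDl.
rewrite lte_fin => cy; exists ((c + y) / 2); first by lra.
by rewrite lte_fin; lra.
Qed.

Section WeakStarTopology.
Context {R : realType} {X : normedModType R}.
Implicit Types (u w : dual_space X) (s : seq X) (e : R) (b x z : X).

Lemma ptws_nbhs (g : {ptws X -> R^o}) (s : seq X) (e : R) : 0 < e ->
  nbhs g [set h : {ptws X -> R^o} | forall b, b \in s -> `|g b - h b| < e].
Proof.
move=> e0; elim: s => [|b s IH].
  have -> : [set h : {ptws X -> R^o} | forall b, b \in [::] -> `|g b - h b| < e] = setT.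
    by rewrite -subTset => h _ b.
  exact: filterT.
have gb : nbhs g [set h : {ptws X -> R^o} | `|g b - h b| < e].
  apply: (@proj_continuous X (fun=> R^o) b g [set y | `|g b - y| < e]).
  by apply/nbhs_ballP; exists e => //= y; rewrite -ball_normE.
apply: filterS (filterI gb IH) => h [hb hs] c; rewrite inE.
by move=> /predU1P[->|/hs].
Qed.

(** The filter generated by conditions on finitely many evaluations converges pointwise to [u], so
    it contains every neighbourhood of [u]. *)
Lemma weak_star_nbhs (u : weak_star X) (B : set (weak_star X)) : nbhs u B ->
  exists s, exists2 e, 0 < e &
    forall w, (forall b, b \in s -> `|ev u b - ev w b| < e) -> B w.
Proof.
move=> [_ [[U openU <-] Uu UB]].
pose G : set_system {ptws X -> R^o} := [set V | exists s, exists2 e, 0 < e &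
  forall h : X -> R^o, (forall b, b \in s -> `|ev u b - h b| < e) -> V h].
have GF : Filter G.
  split.
  - by exists [::], 1.
  - move=> V W [s [e e0 sV]] [s' [e' e'0 sW]].
    exists (s ++ s'), (Order.min e e'); first by rewrite lt_min e0.
    move=> h hb; split; [apply: sV|apply: sW] => b bs;
      have := hb b; rewrite mem_cat bs ?orbT => /(_ isT);
      by rewrite lt_min => /andP[].
  - by move=> V W VW [s [e e0 sV]]; exists s, e => // h /sV/VW.
have Gu : G --> ((u : X -> R^o) : {ptws X -> R^o}).
  apply/pointwise_cvgP => b; apply/cvgrPdist_lt => e e0.
  by exists [:: b], e => // h; apply; rewrite inE.
have [|s [e e0 sU]] := Gu U; first exact: open_nbhs_nbhs.
by exists s, e => // w ws; apply: UB; exact: sU.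
Qed.

(** Banach-Alaoglu for a family shrinking with [e]: Tychonoff's theorem on the product of the
    segments [-K|x|, K|x|] gives a cluster point, linear because members of [P] approximate it at
    three points at once. *)
Lemma weak_star_compactness (P : R -> set (dual_space X)) (K : R) :
  (forall e, 0 < e -> P e !=set0) ->
  (forall e e', e <= e' -> P e `<=` P e') ->
  (forall e u, P e u -> forall x, `|ev u x| <= K * `|x|) ->
  exists u, forall e e' s, 0 < e -> 0 < e' -> exists2 w, P e w &
    forall b, b \in s -> `|ev u b - ev w b| < e'.
Proof.
move=> P0 Pmono PK.
pose G : set_system {ptws X -> R^o} := filter_from [set e : R | 0 < e]
  (fun e => [set h : {ptws X -> R^o} | exists2 w, P e w & h = (w : X -> R^o)]).
have GF : ProperFilter G.
  apply: (@filter_from_proper _ _ [set e : R | 0 < e]); last first.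
    by move=> e /P0[w Pw]; exists w; exists w.
  apply: filter_from_filter; first by exists 1 => /=.
  move=> e e' /= e0 e'0; exists (Order.min e e'); first by rewrite /= lt_min e0.
  move=> _ [w Pw ->]; split; exists w => //.
    by apply: Pmono Pw; rewrite ge_min lexx.
  by apply: Pmono Pw; rewrite ge_min lexx orbT.
have cpt : compact [set h : {ptws X -> R^o} |
    forall x, `[- (K * `|x|), K * `|x|]%classic (h x)].
  apply: (@tychonoff X (fun=> R^o) (fun x => `[- (K * `|x|), K * `|x|]%classic)).
  by move=> x; exact: segment_compact.
have [|g [_ clg]] := cpt G GF.
  exists 1 => //= _ [w Pw ->] x /=; rewrite in_itv/= -ler_norml.
  exact: PK Pw x.
have approx e e' s : 0 < e -> 0 < e' -> exists2 w, P e w &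
    forall b, b \in s -> `|g b - ev w b| < e'.
  move=> e0 e'0; have Ge : G [set h : {ptws X -> R^o} |
    exists2 w, P e w & h = (w : X -> R^o)] by exists e.
  have [_ [[w Pw ->] ws]] := clg _ _ Ge (ptws_nbhs g s e'0).
  by exists w.
have gK x : g x <= K * `|x|.
  apply/ler_addgt0Pr => e e0; have [w Pw ws] := approx 1 e [:: x] ltr01 e0.
  have := ws x (mem_head _ _); have := PK _ _ Pw x.
  by rewrite ltr_norml ler_norml => /andP[_ ?] /andP[_ ?]; lra.
have linL : linear g.
  move=> t x y; apply/eqP; rewrite -subr_eq0 -normr_le0.
  apply/ler_addgt0Pr => e e0; rewrite add0r.
  (* The three errors d, |t|d and d add up to [e]. *)
  pose d := e / (2 + `|t|).
  have t2 : 0 < 2 + `|t| by rewrite ltr_pwDl.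
  have d0 : 0 < d by rewrite divr_gt0.
  have [w Pw ws] := approx 1 d [:: t *: x + y; x; y] ltr01 d0.
  have h1 := ws (t *: x + y); have h2 := ws x; have h3 := ws y.
  rewrite !inE !eqxx ?orbT /= in h1 h2 h3.
  have {}h1 := h1 isT; have {}h2 := h2 isT; have {}h3 := h3 isT.
  rewrite dualD dualZ in h1.
  change (`|g (t *: x + y) - (t * g x + g y)| <= e).
  have -> : g (t *: x + y) - (t * g x + g y) =
    (g (t *: x + y) - (t * ev w x + ev w y)) - t * (g x - ev w x)
      - (g y - ev w y) by ring.
  have -> : e = d + `|t| * d + d by rewrite /d; field; rewrite gt_eqF.
  apply: (le_trans (ler_normB _ _)); apply: lerD (ltW h3).
  apply: (le_trans (ler_normB _ _)); apply: lerD (ltW h1) _.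
  by rewrite normrM ler_wpM2l// ltW.
have [u ug] := bounded_dual linL gK.
exists u => e e' s e0 e'0; have [w Pw ws] := approx e e' s e0 e'0.
by exists w => // b bs; rewrite ug; exact: ws.
Qed.

End WeakStarTopology.

(** * Monotonicity and closedness of representable operators *)

Section RepresentableOperators.
Context {R : realType} {X : normedModType R}.
Variable T : X -> set (dual_space X).
Implicit Types (u v : dual_space X) (a b c w x y z : X).

(** By convexity of [f], the pairing at the midpoint is at most the average of the two pairings; the
    difference is a quarter of <x1 - x2, u1 - u2>. *)
Lemma representable_monotone : representable T -> monotone_multi T.
Proof.
move=> [f [_ cf _ fge fT]] x1 x2 u1 u2 T1 T2.
have f1 : f (x1, u1) = (ev u1 x1)%:E.
  by have := T1; rewrite fT.
have f2 : f (x2, u2) = (ev u2 x2)%:E.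
  by have := T2; rewrite fT.
change (0 <= ev (u1 - u2) (x1 - x2)).
have h0 : 0 <= 2^-1 :> R by rewrite invr_ge0.
have h1 : 2^-1 <= 1 :> R by lra.
have := cf (Itv01 h0 h1) (x1, u1) (x2, u2).
rewrite f1 f2 /= => h.
have := fge (2^-1 *: x1 + (1 - 2^-1) *: x2) (2^-1 *: u1 + (1 - 2^-1) *: u2).
move=> /le_trans/(_ h); rewrite -!EFinM -EFinD lee_fin.
change (ev (2^-1 *: u1 + (1 - 2^-1) *: u2) (2^-1 *: x1 + (1 - 2^-1) *: x2) <=
  2^-1 * ev u1 x1 + (1 - 2^-1) * ev u2 x2 -> 0 <= ev (u1 - u2) (x1 - x2)).
rewrite !dual_addE !dual_scaleE dual_oppE !dualD !dualN !dualZ.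
have -> : 1 - 2^-1 = 2^-1 :> R by lra.
lra.
Qed.

(** Bounded values at points tending to [z] have a weak-star cluster point g. Boundedness lets the
    pairing pass to the limit, and lower semicontinuity gives f(z, g) <= g(z). *)
Lemma representable_domain_closed z (K : R) : representable T ->
  (forall e : R, 0 < e -> exists a u,
    [/\ T a u, `|z - a| < e & forall x, `|ev u x| <= K * `|x|]) ->
  domain T z.
Proof.
move=> [f [_ cf lscf fge fT]] Tz.
pose P (e : R) := [set u | exists2 a, T a u &
  `|z - a| < e /\ forall x, `|ev u x| <= K * `|x|].
have [e e0|e e' ee' u [a Tau [za uK]]|e u [a _ []]//|g gP] :=
    @weak_star_compactness _ _ P K.
- by have [a [u [Tau za uK]]] := Tz e e0; exists u, a.
- by exists a => //; split=> //; exact: lt_le_trans ee'.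
have Tfz u : f (z, u) = (ev u z)%:E -> T z u.
  move=> fzu; have : [set t | f t = (t.2 t.1)%:E] (z, u) by [].
  by rewrite -fT.
exists g; apply: Tfz; apply: le_anti; rewrite fge andbT.
rewrite leNgt; apply/negP => /lt_EFin_between[r gr /(lscf (z, g))].
move=> [V [[V1 V2] /= [/nbhs_ballP[e1 /= e10 e1V] gV2] VV] Vr].
have [s [e2 e20 sV2]] := weak_star_nbhs gV2.
have K0 : 0 <= `|K| by [].
(* Passing from u(a) to u(z) costs at most |K|e and from u(z) to g(z) at most e, in all at most half
   of [r - ev g z]. *)
pose e := Order.min e1 ((r - ev g z) / (2 * (1 + `|K|))).
have d0 : 0 < 2 * (1 + `|K|) by rewrite mulr_gt0// ltr_pwDl.
have e0 : 0 < e by rewrite lt_min e10 divr_gt0// subr_gt0.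
have eK : e * (2 * (1 + `|K|)) <= r - ev g z.
  by rewrite -ler_pdivlMr// ge_min lexx orbT.
have e'0 : 0 < Order.min e e2 by rewrite lt_min e0.
have [u [a Tau [za uK]] us] := gP e (Order.min e e2) (z :: s) e0 e'0.
have : (r%:E < f (a, u))%E.
  apply: Vr; apply: VV; split=> /=.
    apply: e1V; rewrite -ball_normE /=; apply: (lt_le_trans za).
    by rewrite ge_min lexx.
  apply: sV2 => b bs; have := us b; rewrite inE bs orbT => /(_ isT).
  by rewrite lt_min => /andP[].
have : graph T (a, u) by [].
rewrite fT /= => ->; rewrite lte_fin; change (r < ev u a -> False).
have := us z (mem_head _ _); rewrite lt_min => /andP[+ _].
rewrite ltr_norml => /andP[h1 _].
have := uK (a - z); rewrite dualB ler_norml => /andP[_ h2].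
have h3 : K * `|a - z| <= `|K| * e.
  apply: (@le_trans _ _ (`|K| * `|a - z|)).
    by rewrite ler_wpM2r// ler_norm.
  by rewrite ler_wpM2l// distrC ltW.
have : 0 <= `|K| * e by rewrite mulr_ge0// ltW.
by move: h1 h2 eK h3 gr; rewrite -/(ev g z); lra.
Qed.

End RepresentableOperators.

(** * Separation from an epigraph *)

Section Separation.
Context {R : realType} {X : normedModType R}.
Variable T : X -> set (dual_space X).
Implicit Types (u v w : dual_space X) (a b c x y z : X).

Lemma linear_row (k : nat) (M : 'rV[R]_k -> R) (r : 'rV[R]_k) : linear M ->
  M r = \sum_i r ord0 i * M (delta_mx ord0 i).
Proof.
move=> linM; pose Ml : {linear 'rV[R]_k -> R^o} :=
  HB.pack (M : _ -> R^o) (GRing.isLinear.Build _ _ _ _ (M : _ -> R^o) linM).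
rewrite -[M]/(Ml : _ -> R) {1}[r]row_sum_delta linear_sum.
by apply: eq_bigr => i _; rewrite linearZ.
Qed.

Lemma epi_convex (f : X * dual_space X -> \bar R) (x1 x2 : X) u1 u2
    (p1 p2 t : R) : convex_efun f -> 0 <= t <= 1 ->
  (f (x1, u1) <= p1%:E)%E -> (f (x2, u2) <= p2%:E)%E ->
  (f ((t *: x1 + (1 - t) *: x2)%R, (t *: u1 + (1 - t) *: u2)%R) <=
    (t * p1 + (1 - t) * p2)%R%:E)%E.
Proof.
move=> cf /andP[t0 t1] f1 f2.
have := cf (Itv01 t0 t1) (x1, u1) (x2, u2) => /= /le_trans; apply.
have -> : (t * p1 + (1 - t) * p2)%:E =
  (t%:E * p1%:E + (1 - t)%:E * p2%:E)%E by [].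
by apply: leeD; apply: lee_wpmul2l => //; rewrite lee_fin// subr_ge0.
Qed.

(* This separates (x0, u0, 0) from the epigraph of the function
   (x, u) |-> f (x, u) - u0(x) - u(x0) + u0(x0), which is positive at (x0, u0). *)
Lemma lsc_convex_separation (f : X * dual_space X -> \bar R) x0 u0 :
  proper_efun f -> convex_efun f ->
  lower_semicontinuous (f : X * weak_star X -> \bar R) ->
  ((ev u0 x0)%:E < f (x0, u0))%E ->
  exists (xi : dual_space X) (v : X) (tau : R), 0 <= tau /\
    forall x u (p : R), (f (x, u) <= p%:E)%E ->
    1 <= ev xi (x - x0) + ev (u - u0) v +
      tau * (p - ev u0 x - ev u x0 + ev u0 x0).
Proof.
move=> [fNy [[xp up] fp]] cf lscf /lt_EFin_between[r r0 /(lscf (x0, u0))].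
move=> [V [[V1 V2] /= [/nbhs_ballP[e1 /= e10 e1V] uV2] VV] Vr].
have [s [e2 e20 sV2]] := weak_star_nbhs uV2.
pose c := ev u0 x0.
(* [p - c] is the sum of [tr x u p], u0(x - x0) and (u - u0)(x0); if each is below [be], then
   [p < r]. *)
pose be := (r - c) / 3.
have be0 : 0 < be by rewrite divr_gt0// subr_gt0.
have [K0 K00 u0K] := dual_bounded u0.
pose s' := x0 :: s; pose k := size s'.
pose V' := ('rV[R]_k : lmodType R).
(* A weak-star neighbourhood constrains finitely many evaluations, so [u] enters only through a row
   of [k] numbers. In this variable the functional found is then an evaluation at a vector of
   [X]. *)
pose W : lmodType R := (X * 'rV[R]_k * R^o)%type.
(* Large enough that a value of [N] below 1 forces both neighbourhood conditions and the three
   errors below [be]. *)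
pose K := e1^-1 + e2^-1 + be^-1 + K0 / be.
have [K1 K2 K3 K4] : [/\ e1^-1 <= K, e2^-1 <= K, be^-1 <= K & K0 / be <= K].
  have := ltW K00; have := ltW be0.
  rewrite -(invr_gt0 e1) in e10; rewrite -(invr_gt0 e2) in e20.
  rewrite -(invr_gt0 be) in be0 => be1 K01.
  have : 0 <= K0 / be by rewrite divr_ge0.
  by rewrite /K; split; lra.
have Kp : 0 < K by apply: lt_le_trans K1; rewrite invr_gt0.
pose N (z : W) := K * (`|z.1.1| + \sum_i `|z.1.2 ord0 i| + `|z.2 : R|).
have sN : sublinear N.
  split=> [z z'|t z t0]; rewrite /N /=.
    rewrite -mulrDr ler_wpM2l ?(ltW Kp)//.
    have := ler_normD z.1.1 z'.1.1; have := ler_normD (z.2 : R) z'.2.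
    have : \sum_i `|(z.1.2 + z'.1.2) ord0 i| <=
        \sum_i `|z.1.2 ord0 i| + \sum_i `|z'.1.2 ord0 i|.
      by rewrite -big_split; apply: ler_sum => i _; rewrite mxE ler_normD.
    lra.
  rewrite normrZ normrM gtr0_norm// mulrCA ler_wpM2l ?(ltW Kp)//.
  rewrite !mulrDr lerD2r lerD2l mulr_sumr; apply: ler_sum => i _.
  by rewrite mxE normrM gtr0_norm.
pose tr x u (p : R) := p - ev u0 x - ev u x0 + c.
pose row_of u : 'rV[R]_k := \row_i ev (u - u0) s'`_i.
pose E : set (W * R) := [set z | exists x u (p : R), (f (x, u) <= p%:E)%E /\
  z = ((x - x0, row_of u, tr x u p), -1)].
have [|||L [linL LN LE]] := @sandwich R W N E sN.
- have fpE : (f (xp, up) <= (fine (f (xp, up)))%:E)%E.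
    by rewrite fineK// fin_numE fNy fp.
  by eexists; exists xp, up, (fine (f (xp, up))); split; [exact: fpE|reflexivity].
- move=> t w1 t1 w2 t2 t01 [x1 [u1 [p1 [f1 [-> ->]]]]].
  move=> [x2 [u2 [p2 [f2 [-> ->]]]]].
  exists (t *: x1 + (1 - t) *: x2), (t *: u1 + (1 - t) *: u2),
    (t * p1 + (1 - t) * p2); split; first exact: epi_convex.
  congr pair; last by ring.
  congr pair; first congr pair.
  + rewrite /= !scalerBr addrACA -opprD -scalerDl [t + _]addrC subrK.
    by rewrite scale1r.
  + apply/rowP => i; rewrite !mxE !dual_subE dual_addE !dual_scaleE.
    change (t * (ev u1 s'`_i - ev u0 s'`_i) +
      (1 - t) * (ev u2 s'`_i - ev u0 s'`_i) =
      t * ev u1 s'`_i + (1 - t) * ev u2 s'`_i - ev u0 s'`_i).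
    ring.
  + rewrite /tr dualD !dualZ dual_addE !dual_scaleE.
    change (t * (p1 - ev u0 x1 - ev u1 x0 + c) +
      (1 - t) * (p2 - ev u0 x2 - ev u2 x0 + c) = t * p1 + (1 - t) * p2 -
      (t * ev u0 x1 + (1 - t) * ev u0 x2) -
      (t * ev u1 x0 + (1 - t) * ev u2 x0) + c).
    ring.
- move=> w' t' [x [u [p [fxup [-> ->]]]]] {w' t'}.
  suff : 1 <= N (x - x0, row_of u, tr x u p).
    rewrite /N /= !normrN; set S := \sum_i _ => h1.
    have -> : \sum_i `|(- row_of u) ord0 i| = S.
      by apply: eq_bigr => i _; rewrite [in LHS]mxE normrN.
    lra.
  rewrite leNgt; apply/negP => N1.
  have small (d q : R) : 0 < d -> d^-1 <= K -> 0 <= q -> K * q < 1 -> q < d.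
    move=> d0 dK q0 Kq; rewrite -(@ltr_pM2l _ d^-1) ?invr_gt0//.
    rewrite mulVf ?gt_eqF//; apply: le_lt_trans Kq.
    by rewrite ler_wpM2r.
  move: N1; rewrite /N /=; set S := \sum_i _ => N1.
  have S0 : 0 <= S by apply: sumr_ge0.
  have KS0 : 0 <= K * S by rewrite mulr_ge0// ltW.
  have Kx0 : 0 <= K * `|x - x0| by rewrite mulr_ge0// ltW.
  have Kt0 : 0 <= K * `|tr x u p| by rewrite mulr_ge0// ltW.
  rewrite !mulrDr in N1.
  have xx0 : `|x - x0| < e1 by apply: small => //; lra.
  have K0x : K0 * `|x - x0| < be.
    have : K0 / be * `|x - x0| < 1.
      by apply: (@le_lt_trans _ _ (K * `|x - x0|)); [rewrite ler_wpM2r|lra].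
    by rewrite mulrAC ltr_pdivrMr// mul1r.
  have tbe : `|tr x u p| < be by apply: small => //; lra.
  have rowE i : row_of u ord0 i = ev (u - u0) s'`_i by rewrite mxE.
  have us b d : b \in s' -> 0 < d -> d^-1 <= K -> `|ev (u - u0) b| < d.
    move=> bs d0 dK; apply: small => //.
    have bk : (index b s' < k)%N by rewrite index_mem.
    suff : `|ev (u - u0) b| <= S.
      by rewrite -(@ler_pM2l _ K)// => ?; lra.
    rewrite /S (bigD1 (Ordinal bk))//= rowE /= nth_index// lerDl.
    exact: sumr_ge0.
  have : (r%:E < f (x, u))%E.
    apply: Vr; apply: VV; split => /=.
      by apply: e1V; rewrite -ball_normE /= distrC.
    apply: sV2 => b bs; rewrite distrC -dual_subE; apply: us => //.
    by rewrite inE bs orbT.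
  move=> /lt_le_trans/(_ fxup); rewrite lte_fin => rp.
  have := us x0 be (mem_head _ _) be0 K3; rewrite dual_subE.
  have := u0K (x - x0); rewrite dualB.
  have bec : 3 * be = r - c by rewrite /be; field.
  move: tbe; rewrite ltr_norml /tr => /andP[_ h1].
  rewrite ler_norml => /andP[_ h2]; rewrite ltr_norml => /andP[_ h3].
  by move: h1 h2 h3 bec K0x rp; rewrite /c; lra.
have LD (z z' : W) : L (z + z') = L z + L z'.
  by have := linL 1 z z'; rewrite !scale1r.
have L0 : L 0 = 0 by have := LD 0 0; rewrite addr0; lra.
have LZ t (z : W) : L (t *: z) = t * L z.
  by have := linL t z 0; rewrite L0 !addr0.
pose i1 x : W := (x, 0, 0); pose i2 (q : 'rV[R]_k) : W := (0, q, 0).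
pose i3 : W := (0, 0, 1).
pose L1 x := - L (i1 x); pose L2 q := - L (i2 q).
have linL1 : linear L1.
  move=> t x y; rewrite /L1.
  have -> : i1 (t *: x + y) = t *: i1 x + i1 y.
    by congr pair; [congr pair|]; rewrite /= scaler0 addr0.
  by rewrite LD LZ opprD -mulrN.
have linL2 : linear L2.
  move=> t x y; rewrite /L2.
  have -> : i2 (t *: x + y) = t *: i2 x + i2 y.
    by congr pair; [congr pair|]; rewrite /= scaler0 addr0.
  by rewrite LD LZ opprD -mulrN.
have [xi xiE] : exists xi : dual_space X, forall x, ev xi x = L1 x.
  apply: (@bounded_dual _ _ L1 K linL1) => x; rewrite /L1.
  have -> : - L (i1 x) = L (i1 (- x)).
    have -> : i1 (- x) = (-1) *: i1 x.
      by congr pair; [congr pair|]; rewrite /= ?scaler0 ?scaleN1r.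
    by rewrite LZ mulN1r.
  apply: (le_trans (LN _)); rewrite /N /= normrN normr0 addr0.
  by rewrite big1 ?addr0// => i _; rewrite mxE normr0.
pose tau := - L i3.
have LE' x u p : (f (x, u) <= p%:E)%E ->
    1 <= ev xi (x - x0) + L2 (row_of u) + tau * tr x u p.
  move=> fxup.
  have /LE : E ((x - x0, row_of u, tr x u p), -1) by exists x, u, p.
  have -> : ((x - x0, row_of u, tr x u p) : W) = i1 (x - x0) +
      i2 (row_of u) + tr x u p *: i3.
    congr pair; [congr pair|]; rewrite /= ?scaler0 ?addr0 ?add0r//.
    by rewrite [RHS]mulr1.
  by rewrite !LD LZ xiE /L1 /L2 /tau; lra.
pose v : X := \sum_i L2 (delta_mx ord0 i) *: s'`_i.
have rowv u : L2 (row_of u) = ev (u - u0) v.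
  rewrite (linear_row _ linL2) /v (big_morph (ev (u - u0)) (dualD _) (dual0 _)).
  by apply: eq_bigr => i _; rewrite dualZ mxE mulrC.
exists xi, v, tau; split.
  (* Were [tau] negative, raising [p] over one point of the epigraph would violate the
     inequality. *)
  rewrite leNgt; apply/negP => tau0.
  pose p0 := fine (f (xp, up)).
  have fp0 : f (xp, up) = p0%:E by rewrite fineK// fin_numE fNy fp.
  pose C := ev xi (xp - x0) + L2 (row_of up) + tau * tr xp up p0.
  have Ct : `|C| / - tau * tau = - `|C| by field; rewrite lt_eqF.
  have C0 : 0 <= `|C| / - tau by rewrite divr_ge0// oppr_ge0 ltW.
  have := LE' xp up (p0 + `|C| / - tau).
  rewrite fp0 lee_fin lerDl C0 => /(_ isT).
  have -> : tr xp up (p0 + `|C| / - tau) = tr xp up p0 + `|C| / - tau.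
    by rewrite /tr; ring.
  by have := ler_norm C; rewrite mulrDr [tau * (_ / _)]mulrC Ct /C; lra.
by move=> x u p /LE'; rewrite rowv.
Qed.

(** Shift [(x0, u0)] by - th (v, xi), with v and xi from the separation. A product m = <x0 - a, u0 -
    w> becomes at least (1 - th tau) m + th + th^2 xi(v). *)
Lemma representable_strict_gap x0 u0 : representable T ->
  (forall a w, T a w -> 0 <= ev (u0 - w) (x0 - a)) -> ~ T x0 u0 ->
  exists (x1 : X) (u1 : dual_space X), exists2 de : R, 0 < de &
    forall a w, T a w -> de <= ev (u1 - w) (x1 - a).
Proof.
move=> [f [pf cf lscf fge fT]] mr nT.
have lt0 : ((ev u0 x0)%:E < f (x0, u0))%E.
  rewrite lt_neqAle fge andbT; apply/negP => /eqP fx0; apply: nT.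
  have : [set t | f t = (t.2 t.1)%:E] (x0, u0) by [].
  by rewrite -fT.
have [xi [v [tau [tau0 sep]]]] := lsc_convex_separation pf cf lscf lt0.
(* Now th tau and th |xi(v)| are at most 1/2, which leaves a gap [th / 2]. *)
pose th := (2 * (1 + tau + `|ev xi v|))^-1.
have d0 : 0 < 2 * (1 + tau + `|ev xi v|).
  by rewrite mulr_gt0// ltr_wpDr// ltr_pwDl.
have th0 : 0 < th by rewrite invr_gt0.
have thd : th * (2 * (1 + tau + `|ev xi v|)) = 1 by rewrite mulVf// gt_eqF.
exists (x0 - th *: v), (u0 - th *: xi), (th / 2); first by rewrite divr_gt0.
move=> a w Taw.
have faw : (f (a, w) <= (ev w a)%:E)%E.
  by have : graph T (a, w) by []; rewrite fT /= => ->.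
have := sep _ _ _ faw; have := mr _ _ Taw.
rewrite !dual_subE !dualB !dual_scaleE !dualZ.
set m := ev u0 x0 - ev u0 a - (ev w x0 - ev w a) => m0.
have -> : ev w a - ev u0 a - ev w x0 + ev u0 x0 = m by rewrite /m; ring.
move=> sep1.
have : th * 1 <= th * (ev xi a - ev xi x0 + (ev w v - ev u0 v) + tau * m).
  by rewrite ler_wpM2l// ltW.
have : 0 <= m * (th * (2 + 2 * `|ev xi v|)).
  by rewrite mulr_ge0// mulr_ge0 ?(ltW th0)// addr_ge0// mulr_ge0.
have : - (th * th * `|ev xi v|) <= th * th * ev xi v.
  rewrite -mulrN ler_wpM2l ?mulr_ge0 ?(ltW th0)//.
  by rewrite lerNl -normrN ler_norm.
have : m * (th * (2 * (1 + tau + `|ev xi v|))) = m by rewrite thd mulr1.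
have : th * (th * (2 * (1 + tau + `|ev xi v|))) = th by rewrite thd mulr1.
have : 0 <= th * th * tau by rewrite !mulr_ge0// ltW.
have : 0 <= th * th by rewrite mulr_ge0// ltW.
have : 0 <= m * (th * tau) by rewrite mulr_ge0// mulr_ge0// ltW.
rewrite /m in m0 *.
nra.
Qed.

End Separation.

(** * Sufficiency of the conditions *)

Section Maximality.
Context {R : realType} {X : completeNormedModType R}.
Variable T : X -> set (dual_space X).
Implicit Types (u v n : dual_space X) (a b h x y : X) (r s t de : R).
Local Notation D := (domain T).
Local Notation A := (aff D).
Local Notation F := (direction A).

Hypotheses (cA : closed A) (icD0 : ic D !=set0)
  (TN : T = multi_add T (normal_cone A)) (reprT : representable T)
  (growth : forall x, (D `\` ic D) x -> exists2 y, ic D y &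
    ereal_sup [set (u (x - y))%:E | u in T x] = +oo%E).

Let affA : affine_set A := @affine_set_aff _ _ D.

Let D0 : D !=set0.
Proof. by case: icD0 => y icy; exists y; exact: ic_domain_sub icy. Qed.

Let sF : linear_subspace F.
Proof.
by apply: direction_subspace => //; case: D0 => x Dx; exists x; exact: subset_aff.
Qed.

(** Such an [n] is normal to the affine hull at each of its points, so [TN] absorbs it. *)
Lemma add_annihilator x u n : T x u -> (forall b, F b -> ev n b = 0) ->
  T x (u + n).
Proof.
move=> Txu nF; have Ax := aff_domain Txu.
rewrite TN; exists u => //; exists n => //; split=> // y Ay.
by have := nF _ (directionB Ax Ay); rewrite /ev => ->.
Qed.

(** Otherwise some [n] vanishes on [F] and equals 1 at [x1 - y]; adding a suitable multiple of it to
    a value at [y] brings the product with [(x1, u1)] down to 0. *)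
Lemma strict_gap_in_aff x1 u1 de : 0 < de ->
  (forall a w, T a w -> de <= ev (u1 - w) (x1 - a)) -> A x1.
Proof.
move=> de0 gap; apply: contrapT => nAx1.
have [y [v Tyv]] := D0; have Ay := aff_domain Tyv.
have nF : ~ F (x1 - y).
  by move=> /(affine_setD affA Ay); rewrite addrC subrK.
have [n [nF0 n1]] := dual_annihilator sF (direction_closed affA cA) nF.
pose k := ev (u1 - v) (x1 - y).
have : T y (v + k *: n).
  by apply: add_annihilator => // b Fb; rewrite dual_scaleE nF0// mulr0.
move=> /gap; rewrite dual_subE dual_addE dual_scaleE n1 /k dual_subE; lra.
Qed.

(** * Propagation of the domain along a segment *)

Section Segment.
Variables (x1 y0 : X) (u1 : dual_space X) (de r M : R).
Hypotheses (de0 : 0 < de)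
  (gap : forall a w, T a w -> de <= ev (u1 - w) (x1 - a))
  (icy0 : ic D y0) (r0 : 0 < r)
  (y0r : forall a u p, fitz_epi T a u p -> forall b, F b -> `|b| <= r ->
    ev u b <= p - ev u y0 + M * (1 + `|a|)).

Let h := x1 - y0.
Let seg s := y0 + s *: h.
Let B := `|ev u1 h| + `|M| * (1 + `|y0| + `|h|).

Let Ay0 : A y0.
Proof. by apply: subset_aff; exact: ic_domain_sub icy0. Qed.

Let Ax1 : A x1 := strict_gap_in_aff de0 gap.

Let Fh : F h := directionB Ay0 Ax1.

Let Kr : R := B / r.

Let Kr0 : 0 <= Kr.
Proof.
by rewrite divr_ge0 ?(ltW r0)// addr_ge0// mulr_ge0// !addr_ge0.
Qed.

Lemma segment_gap s u : T (seg s) u -> de <= (1 - s) * (ev u1 h - ev u h).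
Proof.
move=> /gap; have -> : x1 - seg s = (1 - s) *: h.
  by rewrite /seg opprD addrA scalerBl scale1r.
by rewrite dualZ dual_subE.
Qed.

(** The estimate at [y0], used at the graph point [(seg s, u)], bounds u on the ball of radius [r]
    of [F] by s u(h) plus a constant, and the gap gives u(h) <= u1(h). The bound does not depend on
    [s]. *)
Lemma segment_bound s u b : 0 <= s < 1 -> T (seg s) u -> F b ->
  `|ev u b| <= Kr * `|b|.
Proof.
move=> /andP[s0 s1] Tsu Fb.
have gp := segment_gap Tsu.
have uh : ev u h <= ev u1 h.
  have : 0 < 1 - s by rewrite subr_gt0.
  move=> s1'; rewrite -subr_ge0 -(pmulr_rge0 _ s1').
  by apply: le_trans gp; exact: ltW.
have ball_bound c : F c -> `|c| <= r -> ev u c <= B.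
  move=> Fc cr.
  have := y0r (fitz_epi_graph (representable_monotone reprT) Tsu) Fc cr.
  have -> : ev u (seg s) - ev u y0 = s * ev u h.
    by rewrite /seg dualD dualZ; ring.
  have : s * ev u h <= `|ev u1 h|.
    apply: (@le_trans _ _ (s * ev u1 h)); first by rewrite ler_wpM2l.
    apply: (@le_trans _ _ (s * `|ev u1 h|)).
      by rewrite ler_wpM2l// ler_norm.
    by rewrite ler_piMl// ltW.
  have : M * (1 + `|seg s|) <= `|M| * (1 + `|y0| + `|h|).
    apply: (@le_trans _ _ (`|M| * (1 + `|seg s|))).
      by rewrite ler_wpM2r ?ler_norm// addr_ge0.
    rewrite ler_wpM2l// -addrA lerD2l /seg.
    apply: (le_trans (ler_normD _ _)); rewrite lerD2l normrZ ger0_norm//.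
    by rewrite ler_piMl// ltW.
  by rewrite /B; lra.
have [->|b0] := eqVneq b 0; first by rewrite dual0 !normr0 mulr0.
have nb : 0 < `|b| by rewrite normr_gt0.
have rb : 0 < r / `|b| by rewrite divr_gt0.
have upper c : F c -> `|c| = `|b| -> ev u c <= Kr * `|b|.
  move=> Fc cb; have := ball_bound ((r / `|b|) *: c) (linear_subspaceZ _ sF Fc).
  rewrite normrZ gtr0_norm// cb divfK ?gt_eqF// lexx dualZ => /(_ isT).
  by rewrite -ler_pdivlMl// invf_div mulrC mulrA mulrAC.
rewrite ler_norml upper// andbT lerNl -dualN; apply: upper; last exact: normrN.
exact: linear_subspaceN.
Qed.

(** Extend the restriction of a value to [F] without enlarging its bound; the extension differs from
    the value by an annihilator of [F]. *)
Lemma segment_bounded_selection s : 0 <= s < 1 -> D (seg s) ->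
  exists2 u, T (seg s) u & forall x, `|ev u x| <= Kr * `|x|.
Proof.
move=> s01 [u Tsu].
have [v [vK vu]] := dual_extension Kr0 sF (fun b Fb => segment_bound s01 Tsu Fb).
exists v => //; rewrite -[v](subrK u) addrC; apply: add_annihilator => // b Fb.
by rewrite dual_subE vu// subrr.
Qed.

(** Values bounded on [F] rule out the infinite supremum in [growth]. *)
Lemma segment_ic s : 0 <= s < 1 -> D (seg s) -> ic D (seg s).
Proof.
move=> s01 Ds; apply: contrapT => nics.
have [y icy] := growth (conj Ds nics).
have Fsy : F (seg s - y).
  apply: directionB; last exact: subset_aff.
  by apply: subset_aff; exact: ic_domain_sub icy.
have : (ereal_sup [set (u (seg s - y))%:E | u in T (seg s)] <=
    (Kr * `|seg s - y|)%:E)%E.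
  apply: ge_ereal_sup => _ [u Tsu <-]; rewrite lee_fin.
  exact: le_trans (ler_norm _) (segment_bound s01 Tsu Fsy).
by move=> /[swap] ->.
Qed.

(** Let [ta] be the infimum of the bad parameters. Closedness puts [seg ta] in D(T), hence in
    [ic D], so points slightly further towards [x1] are in D(T) too, a contradiction. *)
Lemma segment_domain s : 0 <= s < 1 -> D (seg s).
Proof.
move=> s01; apply: contrapT => nDs.
pose S := [set t | 0 <= t < 1 /\ ~ D (seg t)].
have Ss : S s by [].
have lbS : has_lbound S by exists 0 => t [/andP[]].
pose ta := inf S.
have ta0 : 0 <= ta by apply: lb_le_inf; [exists s|move=> t [/andP[]]].
have tas : ta <= s by exact: ge_inf.
have ta1 : ta < 1 by apply: le_lt_trans tas _; case/andP: s01.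
have Dbelow t : 0 <= t < ta -> D (seg t).
  move=> /andP[t0 tta]; apply: contrapT => nDt.
  have : ta <= t by apply: ge_inf => //; split=> //; rewrite t0 (lt_trans tta).
  by rewrite leNgt tta.
have seg0 : D (seg 0).
  by rewrite /seg scale0r addr0; exact: ic_domain_sub icy0.
have Dta : D (seg ta).
  apply: (@representable_domain_closed _ _ _ _ Kr reprT) => e e0.
  pose q := e / (2 * (1 + `|h|)).
  have d0 : 0 < 2 * (1 + `|h|) by rewrite mulr_gt0// ltr_pwDl.
  have q0 : 0 < q by rewrite divr_gt0.
  have qe : q * (2 * (1 + `|h|)) = e by rewrite divfK// gt_eqF.
  (* If [ta - q] is not positive, then [t] is 0 and the point is [y0], known to lie in D(T). *)
  pose t := Order.max 0 (ta - q).
  have t0 : 0 <= t by rewrite le_max lexx.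
  have tq : ta - q <= t by rewrite le_max lexx orbT.
  have tta : t <= ta by rewrite ge_max ta0 gerBl ltW.
  have Dt : D (seg t).
    have [t0'|t0'] := leP t 0.
      by have -> : t = 0 by apply: le_anti; rewrite t0 t0'.
    apply: Dbelow; rewrite t0 /=.
    by move: t0'; rewrite lt_max ltxx /= => ?; rewrite gt_max; apply/andP; split; lra.
  have [|u Ttu uK] := @segment_bounded_selection t _ Dt.
    by rewrite t0 (le_lt_trans tta).
  exists (seg t), u; split=> //.
  rewrite /seg opprD addrACA subrr add0r -scalerBl normrZ ger0_norm ?subr_ge0//.
  have : (ta - t) * `|h| <= q * `|h| by rewrite ler_wpM2r//; lra.
  have : 0 <= q * `|h| by rewrite mulr_ge0// ltW.
  lra.
have := @segment_ic ta; rewrite ta0 ta1 => /(_ isT Dta).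
rewrite /ic asboolT// => -[_ /(_ x1 Ax1)[rho rho0 xrho]].
have ta1' : 0 < 1 - ta by rewrite subr_gt0.
have e0 : 0 < rho * (1 - ta) by rewrite mulr_gt0.
have [t [t01 nDt] tlt] := inf_adherent e0 (conj (ex_intro S s Ss) lbS).
have tta : ta <= t by apply: ge_inf.
(* [seg t] is the combination of [seg ta] and [x1] with weight [l] on [x1]; the choice of [t] makes
   [l <= rho]. *)
apply: nDt; pose l := (t - ta) / (1 - ta).
have : 0 <= l <= rho.
  rewrite divr_ge0 ?subr_ge0 ?(ltW ta1)//= ler_pdivrMr// lerBlDl.
  exact: ltW.
have lta : (1 - l) * ta + l = t by rewrite /l; field; rewrite gt_eqF.
have x1E : x1 = y0 + h by rewrite addrC subrK.
have segE k : (1 - l) *: (y0 + ta *: k) + l *: (y0 + k) = y0 + t *: k.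
  rewrite !scalerDr addrACA -scalerDl subrK scale1r scalerA -scalerDl.
  by rewrite lta.
by move=> /xrho; rewrite {1}x1E segE.
Qed.

(** At parameter [1 - q] the gap requires [de <= q * C], with [C] independent of [q]; a small [q]
    violates this. *)
Lemma segment_absurd : False.
Proof.
pose C := `|ev u1 h| + Kr * `|h|.
have C0 : 0 <= C by rewrite addr_ge0// mulr_ge0.
pose q := Order.min 1 (de / (C + 1)).
have C1 : 0 < C + 1 by rewrite ltr_wpDl.
have q0 : 0 < q by rewrite lt_min ltr01 divr_gt0.
have q1 : q <= 1 by rewrite ge_min lexx.
have qC : q * (C + 1) <= de by rewrite -ler_pdivlMr// ge_min lexx orbT.
have s01 : 0 <= 1 - q < 1 by rewrite subr_ge0 q1 gtrBl.
have [u Tu] := segment_domain s01.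
have := segment_gap Tu; rewrite subKr => gp.
have := segment_bound s01 Tu Fh; rewrite ler_norml => /andP[uh _].
have : q * (ev u1 h - ev u h) <= q * C.
  rewrite ler_wpM2l ?(ltW q0)// /C; have := ler_norm (ev u1 h); lra.
lra.
Qed.

End Segment.

Lemma representable_maximal_monotone : maximal_monotone T.
Proof.
have mT := representable_monotone reprT.
split=> // -[S mS [TS nST]].
have [x0 [u0 [Sxu nTxu]]] : exists x0 u0, S x0 u0 /\ ~ T x0 u0.
  apply: contrapT => nex; apply: nST => -[x0 u0] /= Sxu.
  by apply: contrapT => nTxu; apply: nex; exists x0, u0.
have mr a w : T a w -> 0 <= ev (u0 - w) (x0 - a).
  by move=> Taw; apply: (mS x0 a u0 w) => //; exact: (TS (a, w)).
have [x1 [u1 [de de0 gap]]] := representable_strict_gap reprT mr nTxu.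
have [y0 icy0] := icD0.
have := icy0; rewrite {1}/ic asboolT// => /(rel_alg_int_fitz_ball cA).
move=> [r r0 [M y0r]].
exact: (segment_absurd de0 gap icy0 r0 y0r).
Qed.

End Maximality.

Unset Implicit Arguments.

Theorem theorem30 (R : realType) (X : completeNormedModType R)
    (dimX : dim_gt1 X) (T : X -> set (dual_space X))
    (domT : ~ exists a : X, domain T = [set a]) (icT : ic (domain T) !=set0) :
  (maximal_monotone T <->
    [/\ T = multi_add T (normal_cone (aff (domain T))),
        representable T &
        forall x, (domain T `\` ic (domain T)) x -> exists2 y, ic (domain T) y &
          ereal_sup [set (u (x - y))%:E | u in T x] = +oo%E]) /\
  (maximal_monotone T -> ic (domain T) = ri (domain T) /\ nearly_convex (domain T)).
Proof.
(* By definition [ic] is empty when the affine hull is not closed. *)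
have cA : closed (aff (domain T)).
  by case: icT => y; rewrite /ic; case: asboolP.
have D0 : domain T !=set0.
  by case: icT => y /(ic_domain_sub cA) Dy; exists y.
split; last first.
  by move=> maxT; split; [exact: ic_domain_ri|exact: nearly_convex_domain].
split=> [maxT|[TN reprT growth]]; last exact: representable_maximal_monotone.
split.
- by apply: maximal_monotone_normal_cone => //; exact: subset_aff.
- exact: maximal_monotone_representable.
- move=> x Dx; have [y icy] := icT; exists y => //.
  exact: maximal_monotone_unbounded.
Qed.
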